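(* Fix $\alpha>1$. For integers $K,N\ge1$ with $M=\alpha KN$ an integer, let $\bar\Delta_{\mathrm{DPC\text{-}ZF}}(\alpha,KN)=\frac{3}{KN}\bar\beta_{\mathrm{DPC\text{-}ZF}}(M,KN)$ (in dB), where $\bar\beta_{\mathrm{DPC\text{-}ZF}}(M,KN)$ is the expected asymptotic sum-rate loss of zero-forcing relative to dirty paper coding. Then, as $KN\to\infty$ (along values for which $\alpha KN$ is an integer), $$\bar\Delta_{\mathrm{DPC\text{-}ZF}}(\alpha,KN)\to -3\left(\log_2 e+\alpha\log_2\left(1-\frac1\alpha\right)\right)\quad\text{(dB)}.$$
   Context: MIMO broadcast channel: $M$ transmit antennas, $K$ users with $N$ antennas each, $M\ge KN$, stacked channel $\mathbf H\in\mathbb C^{KN\times M}$ with i.i.d. zero-mean unit-variance circularly-symmetric complex Gaussian entries, unit noise, total power $P$. $\mathcal C_{\mathrm{DPC}}(\mathbf H,P)=\max\{\log_2|\mathbf I+\sum_k\mathbf H_k^H\mathbf Q_k\mathbf H_k| : \mathbf Q_k\succeq0\ (N\times N),\ \sum_k\mathrm{tr}\mathbf Q_k\le P\}$. For each row $\mathbf h_{k,n}$ of $\mathbf H$, $|g_{k,n}|$ is the norm of the projection of $\mathbf h_{k,n}$ onto the orthogonal complement of the span of the other rows, and $\mathcal C_{\mathrm{ZF}}(\mathbf H,P)=\max_{P_{k,n}\ge0,\sum P_{k,n}\le P}\sum_{k,n}\log_2(1+P_{k,n}|g_{k,n}|^2)$. Then $\bar\beta_{\mathrm{DPC\text{-}ZF}}(M,KN)=\mathbb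 E_{\mathbf H}[\lim_{P\to\infty}(\mathcal C_{\mathrm{DPC}}(\mathbf H,P)-\mathcal C_{\mathrm{ZF}}(\mathbf H,P))]$ (it depends only on $M$ and $KN$). *)

(* Defs.v *)
From HB Require Import structures.
From mathcomp Require Import all_boot all_order all_algebra.
From mathcomp Require Import all_classical all_reals all_analysis.
From mathcomp Require Import complex.
Set Implicit Arguments. Unset Strict Implicit. Unset Printing Implicit Defensive.
Import Order.TTheory GRing.Theory Num.Theory.
Import numFieldNormedType.Exports.
Local Open Scope classical_set_scope.
Local Open Scope ring_scope.

Section MIMO.
Variable R : realType.
Local Notation C := R[i].

Definition log2 (x : R) : R := ln x / ln 2.

Definition abs2 (z : C) : R := complex.Re z ^+ 2 + complex.Im z ^+ 2.

Definition ctrmx m n (A : 'M[C]_(m, n)) : 'M[C]_(n, m) :=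
  (map_mx (@conjc R) A)^T.

(* Q is Hermitian positive semidefinite:  Q^H = Q and x^H Q x >= 0 for all x
   (in the order of C, 0 <= z means z is a nonnegative real). *)
Definition psd n (Q : 'M[C]_n) : Prop :=
  ctrmx Q = Q /\ forall x : 'cV[C]_n, 0 <= (ctrmx x *m Q *m x) 0 0.

(* Row (k, n) of the stacked channel is row k*N + n of H:
   H_k is the N x M block of rows k*N, ..., k*N + N - 1. *)
Definition Hblk K N M (H : 'M[C]_(K * N, M)) (k : 'I_K) : 'M[C]_(N, M) :=
  \matrix_(a < N, j < M) H (mxvec_index k a) j.

(* DPC sum capacity: max over Q_k >= 0 (N x N) with sum_k tr Q_k <= P of
   log2 | I + sum_k H_k^H Q_k H_k |  (the determinant is a positive real). *)
Definition C_DPC K N M (H : 'M[C]_(K * N, M)) (P : R) : R :=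
  sup [set r | exists Q : 'I_K -> 'M[C]_N,
         (forall k, psd (Q k)) /\
         \sum_k \tr (Q k) <= (P%:C)%C /\
         r = log2 (complex.Re
               (\det (1%:M + \sum_k ctrmx (Hblk H k) *m Q k *m Hblk H k)))].

(* |g_j|^2 : squared norm of the projection of row j of H onto the orthogonal
   complement of the span of the other rows, i.e. the squared distance from
   row j to the span of the other rows. *)
Definition g2 n M (H : 'M[C]_(n, M)) (j : 'I_n) : R :=
  inf [set r | exists c : 'rV[C]_n, c 0 j = 0 /\
         r = \sum_l abs2 ((row j H - c *m H) 0 l)].

Definition C_ZF n M (H : 'M[C]_(n, M)) (P : R) : R :=
  sup [set r | exists p : 'I_n -> R,
         (forall j, 0 <= p j) /\ \sum_j p j <= P /\
         r = \sum_j log2 (1 + p j * g2 H j)].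

Definition beta_gap K N M (H : 'M[C]_(K * N, M)) : R :=
  lim ((fun P : R => C_DPC H P - C_ZF H P) @ +oo%R).

(* G (i, j, b) are the real (b = false) and imaginary (b = true) parts of the
   channel entries; they are jointly independent N(0, 1/2) real random
   variables, i.e. the entries are i.i.d. CN(0,1). *)
Definition iid_CN01 (d : measure_display) (T : measurableType d)
  (Pr : probability T R) n M (G : 'I_n -> 'I_M -> bool -> T -> R) : Prop :=
  (forall i j b, measurable_fun setT (G i j b)) /\
  forall B : 'I_n -> 'I_M -> bool -> set R,
    (forall i j b, measurable (B i j b)) ->
    Pr (\bigcap_(t in [set: 'I_n * 'I_M * bool])
           (G t.1.1 t.1.2 t.2 @^-1` B t.1.1 t.1.2 t.2)) =
    (\prod_(t : 'I_n * 'I_M * bool)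
        normal_prob 0 (Num.sqrt (2^-1)) (B t.1.1 t.1.2 t.2))%E.

Definition chan (T : Type) n M (G : 'I_n -> 'I_M -> bool -> T -> R) (w : T)
  : 'M[C]_(n, M) :=
  \matrix_(i < n, j < M) (G i j false w +i* G i j true w)%C.

Definition beta_bar (d : measure_display) (T : measurableType d)
  (Pr : probability T R) K N M (G : 'I_(K * N) -> 'I_M -> bool -> T -> R) : R :=
  fine (\int[Pr]_w (beta_gap (chan G w))%:E)%E.

End MIMO.

(* Main.v *)
Require Import Defs.
From HB Require Import structures.
From mathcomp Require Import all_boot all_order all_algebra.
From mathcomp Require Import all_classical all_reals all_analysis.
From mathcomp Require Import complex.
From mathcomp Require Import ring lra zify measurable_realfun.
Import Order.TTheory GRing.Theory Num.Theory.
Import numFieldNormedType.Exports.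
Local Open Scope classical_set_scope.
Local Open Scope ring_scope.

(* Let n = K N, let W = H H^H, and suppose that H has full row rank.
   By AM-GM for the eigenvalues of W^-1 + Q, both capacities equal
   n log2 (P / n) + const + o(1), so the gap tends to
   log2 det W - sum_j log2 |g_j|^2.  By Gram-Schmidt this is a combination of
   terms log2 (h P h^H), where h is a row of H and P is the orthogonal projection
   onto the complement of the span of m' other rows, of rank m = M - m'.
   Conditionally on the other rows, Gaussian integration by parts in every real
   coordinate of h, applied to the vector field P h / (a + b h P h^H), gives for
   X = h P h^H the identity
   E [X / (a + b X)] = E [m / (a + b X) - b X / (a + b X)^2].
   With a = 1 and b -> 0 this yields E X <= m, and with a -> 0 and b = 1 it yields
   X > 0 almost surely and E X^-1 <= 1 / (m - 1).  Since
   1 - m / X <= ln (X / m) <= X / m - 1, each E ln X differs from ln m by at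
   most 1 / (m - 1), where m - 1 >= (alpha - 1) n.  Hence the expected gap is
   sum_(i < n) log2 (M - i) - n log2 (M - n + 1) + O(1), and comparing the sum of
   logarithms with x ln x - x gives the limit. *)

Set Implicit Arguments.
Unset Strict Implicit.
Unset Printing Implicit Defensive.

(** * Positive semidefinite matrices *)

(** Only the mean of $X$ and the mean of $X^{-1}$ enter, so neither the Gamma law of $X$ nor a
    digamma formula has to be derived. The denominator $a + bX$ keeps the vector field and its
    derivatives bounded, so integration by parts applies before any integrability of $X$ or $X^{-1}$
    is known; the two moments then follow from Fatou's lemma. Real coordinates have variance 1/2,
    which halves the divergence, while the real form of a complex projection of rank $m$ has trace
    $2m$: this is why $m$ itself appears in the identity. Rank deficiency is the recurrent obstacle.
    Almost sure full row rank is itself drawn from $X > 0$, one row at a time, and on the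
    exceptional null set the projection is replaced by 0, so that its algebraic properties hold at
    every sample point. In each direction only the logarithms estimated from below lose something,
    in total at most $n/(M-n) = 1/(\alpha-1)$ nats. This is bounded, so division by $n$ removes
    it. *)

Section ConjugateTranspose.
Variable R : realType.
Local Notation C := R[i].

Lemma ctrmxE m n (A : 'M[C]_(m, n)) i j : ctrmx A i j = (A j i)^*%C.
Proof. by rewrite !mxE. Qed.

Lemma ctrmxK m n (A : 'M[C]_(m, n)) : ctrmx (ctrmx A) = A.
Proof. by apply/matrixP => i j; rewrite !ctrmxE conjcK. Qed.

Lemma ctrmxM m n p (A : 'M[C]_(m, n)) (B : 'M[C]_(n, p)) :
  ctrmx (A *m B) = ctrmx B *m ctrmx A.
Proof. by rewrite /ctrmx map_mxM trmx_mul. Qed.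

Lemma ctrmxD m n (A B : 'M[C]_(m, n)) : ctrmx (A + B) = ctrmx A + ctrmx B.
Proof. by rewrite /ctrmx raddfD /= raddfD. Qed.

Lemma ctrmxB m n (A B : 'M[C]_(m, n)) : ctrmx (A - B) = ctrmx A - ctrmx B.
Proof. by rewrite /ctrmx raddfB /= raddfB. Qed.

Lemma ctrmx1 n : ctrmx (1%:M : 'M[C]_n) = 1%:M.
Proof. by rewrite /ctrmx map_mx1 trmx1. Qed.

Lemma ctrmx0 m n : ctrmx (0 : 'M[C]_(m, n)) = 0.
Proof. by rewrite /ctrmx map_mx0 trmx0. Qed.

Lemma ctrmx_inv n (A : 'M[C]_n) : ctrmx (invmx A) = invmx (ctrmx A).
Proof. by rewrite /ctrmx map_invmx trmx_inv. Qed.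

Lemma ctrmx_row m n (A : 'M[C]_(m, n)) i : ctrmx (row i A) = col i (ctrmx A).
Proof. by apply/matrixP => j k; rewrite !mxE. Qed.

(** Sylvester's identity: the two sides are read off two block triangular factorisations of the same
    matrix. *)
Lemma det_1D_mulmxC m n (A : 'M[C]_(m, n)) (B : 'M[C]_(n, m)) :
  \det (1%:M + A *m B) = \det (1%:M + B *m A).
Proof.
have eqAB : block_mx 1%:M (- A) B 1%:M =
    block_mx (1%:M + A *m B) (- A) 0 1%:M *m block_mx 1%:M 0 B 1%:M.
  rewrite mulmx_block !mulmx1 !mulmx0 mul1mx !add0r mulNmx.
  by rewrite addrK.
have eqBA : block_mx 1%:M (- A) B 1%:M =
    block_mx 1%:M 0 B 1%:M *m block_mx 1%:M (- A) 0 (1%:M + B *m A).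
  rewrite mulmx_block !mulmx1 !mulmx0 !mul0mx !mul1mx !addr0 mulmxN.
  by rewrite addrC addrK.
have := congr1 determinant (etrans (esym eqAB) eqBA).
by rewrite !det_mulmx !det_ublock !det_lblock !det1 !mulr1 !mul1r.
Qed.

Lemma psdD n (A B : 'M[C]_n) : psd A -> psd B -> psd (A + B).
Proof.
move=> [hA pA] [hB pB]; split; first by rewrite ctrmxD hA hB.
by move=> x; rewrite mulmxDr mulmxDl mxE addr_ge0.
Qed.

Lemma psd_congr m n (A : 'M[C]_n) (B : 'M[C]_(n, m)) :
  psd A -> psd (ctrmx B *m A *m B).
Proof.
move=> [hA pA]; split; first by rewrite !ctrmxM ctrmxK hA mulmxA.
by move=> x; have := pA (B *m x); rewrite ctrmxM !mulmxA.
Qed.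

Lemma psd1 n : psd (1%:M : 'M[C]_n).
Proof.
split; first exact: ctrmx1.
move=> x; rewrite mulmx1 mxE sumr_ge0// => i _.
by rewrite ctrmxE mulrC mulcJ_ge0.
Qed.

Lemma psd_gram m n (A : 'M[C]_(m, n)) : psd (A *m ctrmx A).
Proof. by have := psd_congr (ctrmx A) (psd1 n); rewrite ctrmxK mulmx1. Qed.

Lemma psd_inv n (A : 'M[C]_n) : A \in unitmx -> psd A -> psd (invmx A).
Proof.
move=> uA pA; have := psd_congr (invmx A) pA.
by rewrite ctrmx_inv pA.1 (mulVmx uA) mul1mx.
Qed.

Lemma psdZ n (c : R) (A : 'M[C]_n) : 0 <= c -> psd A -> psd (c%:C%C *: A).
Proof.
move=> c0 [hA pA]; split.
  apply/matrixP => i j; rewrite ctrmxE !mxE rmorphM/= oppr0; congr (_ * _).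
  by rewrite -[in RHS]hA ctrmxE.
by move=> x; rewrite -scalemxAr -scalemxAl mxE mulr_ge0// ler0c.
Qed.

(** Of the unitary [U] only invertibility is kept: determinant and trace are invariant under
    similarity. *)
Lemma psd_spectral n (A : 'M[C]_n) : psd A ->
  exists (U : 'M[C]_n) (d : 'I_n -> R), [/\ U \in unitmx, forall i, 0 <= d i &
    A = invmx U *m diag_mx (\row_i (d i)%:C%C) *m U].
Proof.
move=> [hA pA].
have hermA : A \is hermsymmx.
  by apply/is_hermitianmxP; rewrite expr0 scale1r -[LHS]hA /ctrmx map_trmx.
have normA := hermitian_normalmx hermA.
have /orthomx_spectralP AE := normA.
have realD := hermitian_spectral_diag_real hermA.
have uU := spectral_unit A; have unitU := spectral_unitarymx A.
set U := spectralmx A in AE uU unitU *; set D := spectral_diag A in AE realD *.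
have DE : diag_mx D = U *m A *m invmx U.
  by rewrite [in RHS]AE !mulmxA mulmxV// mul1mx mulmxK.
(* The eigenvector for index [i] is the adjoint of row [i] of [U]; testing positivity on it isolates
   the eigenvalue. *)
have D0 i : 0 <= D 0 i.
  have := pA (col i (ctrmx U)).
  have -> : (ctrmx (col i (ctrmx U)) *m A *m col i (ctrmx U)) 0 0 = diag_mx D i i.
    rewrite DE invmx_unitary// -ctrmx_row ctrmxK ctrmx_row -row_mul -!row_mul.
    by rewrite !mxE; apply: eq_bigr => j _; rewrite !mxE.
  by rewrite mxE eqxx.
exists U, (fun i => complex.Re (D 0 i)); split; [exact: uU| |].
  by move=> i; have := D0 i; rewrite lecE => /andP[].
have -> : \row_i (complex.Re (D 0 i))%:C%C = D; last exact: AE.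
by apply/rowP => i; rewrite mxE RRe_real// ger0_real.
Qed.

(** A single list of eigenvalues serves determinant, trace and $\det(I + cA)$ at once, so the matrix
    inequalities below become inequalities between nonnegative reals. *)
Lemma psd_det n (A : 'M[C]_n) : psd A -> exists d : 'I_n -> R,
  [/\ forall i, 0 <= d i, \det A = (\prod_i d i)%:C%C, \tr A = (\sum_i d i)%:C%C &
      forall c : R, \det (1%:M + c%:C%C *: A) = (\prod_i (1 + c * d i))%:C%C].
Proof.
move=> /psd_spectral[U [d [uU d0 AE]]]; exists d; split => //.
- rewrite AE !det_mulmx mulrAC -det_mulmx mulVmx// det1 mul1r det_diag.
  by rewrite rmorph_prod; apply: eq_bigr => i _; rewrite mxE.
- rewrite AE mxtrace_mulC mulmxA mulmxV// mul1mx mxtrace_diag rmorph_sum.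
  by apply: eq_bigr => i _; rewrite mxE.
- move=> c; have -> : 1%:M + c%:C%C *: A =
      invmx U *m diag_mx (\row_i (1 + c * d i)%:C%C) *m U.
    have -> : diag_mx (\row_i (1 + c * d i)%:C%C) =
        1%:M + c%:C%C *: diag_mx (\row_i (d i)%:C%C) :> 'M[C]_n.
      apply/matrixP => i j; rewrite !mxE; case: eqVneq => [->|_].
        by rewrite !mulr1n rmorphD rmorphM.
      by rewrite !mulr0n mulr0 addr0.
    by rewrite mulmxDr mulmx1 mulmxDl mulVmx// -scalemxAr -scalemxAl -AE.
  rewrite !det_mulmx mulrAC -det_mulmx mulVmx// det1 mul1r det_diag.
  by rewrite rmorph_prod; apply: eq_bigr => i _; rewrite mxE.
Qed.

Lemma psd_det_real n (A : 'M[C]_n) : psd A -> \det A = (complex.Re (\det A))%:C%C.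
Proof. by move=> /psd_det[d [_ -> _ _]]. Qed.

Lemma psd_det_ge0 n (A : 'M[C]_n) : psd A -> 0 <= complex.Re (\det A).
Proof. by move=> /psd_det[d [d0 -> _ _]] /=; exact: prodr_ge0. Qed.

Lemma psd_tr_ge0 n (A : 'M[C]_n) : psd A -> 0 <= complex.Re (\tr A).
Proof. by move=> /psd_det[d [d0 _ -> _]] /=; exact: sumr_ge0. Qed.

Lemma psd_det_gt0 n (A : 'M[C]_n) : psd A -> A \in unitmx ->
  0 < complex.Re (\det A).
Proof.
move=> pA uA; rewrite lt_def psd_det_ge0// andbT.
apply/eqP => d0; move: uA; rewrite unitmxE (psd_det_real pA) d0.
by rewrite unitr0.
Qed.

Lemma psd_det_AGM n (A : 'M[C]_n) : (0 < n)%N -> psd A ->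
  complex.Re (\det A) <= (complex.Re (\tr A) / n%:R) ^+ n.
Proof.
move=> n0 /psd_det[d [d0 -> -> _]] /=.
have := @leif_AGM R 'I_n predT d; rewrite card_ord => /(_ (fun i _ => d0 i)).
by move=> /= /leifP; case: ifP => _; [move=> /eqP ->|move/ltW].
Qed.

Lemma psd_det_1D_ge n (c : R) (A : 'M[C]_n) : 0 <= c -> psd A ->
  c ^+ n * complex.Re (\det A) <= complex.Re (\det (1%:M + c%:C%C *: A)).
Proof.
move=> c0 /psd_det[d [d0 -> _ ->]] /=.
rewrite -[X in c ^+ X]card_ord -prodr_const -big_split/= ler_prod// => i _.
by rewrite mulr_ge0//= lerDr.
Qed.

End ConjugateTranspose.

(** * Residuals of rows *)

Section Residual.
Variable R : realType.
Local Notation C := R[i].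

Definition ortho_proj m n (A : 'M[C]_(m, n)) : 'M[C]_n :=
  1%:M - ctrmx A *m invmx (A *m ctrmx A) *m A.

Definition sqnorm n (u : 'rV[C]_n) : R := \sum_l abs2 (u 0 l).

Definition residual m n (A : 'M[C]_(m, n)) (h : 'rV[C]_n) : R :=
  sqnorm (h *m ortho_proj A).

Lemma sqnormE n (u : 'rV[C]_n) : (sqnorm u)%:C%C = (u *m ctrmx u) 0 0.
Proof.
rewrite mxE rmorph_sum /=; apply: eq_bigr => l _.
by rewrite ctrmxE /abs2 add_Re2_Im2 sqr_normc.
Qed.

Lemma sqnorm_ge0 n (u : 'rV[C]_n) : 0 <= sqnorm u.
Proof. by apply: sumr_ge0 => l _; rewrite addr_ge0 ?sqr_ge0. Qed.

Lemma sqnorm_eq0 n (u : 'rV[C]_n) : sqnorm u = 0 -> u = 0.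
Proof.
move=> /psumr_eq0P u0; apply/rowP => l; rewrite mxE.
have : abs2 (u 0 l) = 0 by apply: u0 => // k _; rewrite addr_ge0 ?sqr_ge0.
case: (u 0 l) => a b /eqP; rewrite /abs2/= paddr_eq0 ?sqr_ge0// !sqrf_eq0.
by move=> /andP[/eqP -> /eqP ->].
Qed.

Lemma sqnorm_orthoD n (u v : 'rV[C]_n) : u *m ctrmx v = 0 ->
  sqnorm (u + v) = sqnorm u + sqnorm v.
Proof.
move=> uv0; have vu0 : v *m ctrmx u = 0.
  by rewrite -[v]ctrmxK -ctrmxM uv0 ctrmx0.
apply: complexI; rewrite rmorphD/= !sqnormE ctrmxD mulmxDl !mulmxDr uv0 vu0.
by rewrite addr0 add0r mxE.
Qed.

Section OrthoProj.
Variables (m n : nat) (A : 'M[C]_(m, n)).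
Hypothesis uA : A *m ctrmx A \in unitmx.

Lemma ortho_proj_herm : ctrmx (ortho_proj A) = ortho_proj A.
Proof.
by rewrite /ortho_proj ctrmxB ctrmx1 !ctrmxM ctrmx_inv ctrmxM ctrmxK mulmxA.
Qed.

Lemma mulmx_ortho_proj : A *m ortho_proj A = 0.
Proof. by rewrite mulmxBr mulmx1 !mulmxA mulmxV// mul1mx subrr. Qed.

Lemma ortho_proj_idem : ortho_proj A *m ortho_proj A = ortho_proj A.
Proof.
by rewrite {1}/ortho_proj mulmxBl mul1mx -!mulmxA mulmx_ortho_proj !mulmx0 subr0.
Qed.

Lemma ortho_proj_tr : \tr (ortho_proj A) = n%:R - m%:R.
Proof.
rewrite raddfB /= mxtrace1; congr (_ - _).
by rewrite -mulmxA mxtrace_mulC -mulmxA mulVmx// mxtrace1.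
Qed.

Lemma residualE h : (residual A h)%:C%C = (h *m ortho_proj A *m ctrmx h) 0 0.
Proof.
rewrite sqnormE ctrmxM ortho_proj_herm !mulmxA.
by rewrite -[h *m _ *m ortho_proj A]mulmxA ortho_proj_idem.
Qed.

(** One Gram-Schmidt step: $h P h^H$ is the Schur complement of the block $A A^H$. *)
Lemma det_gram_col_mx (h : 'rV[C]_n) :
  \det (col_mx h A *m ctrmx (col_mx h A)) =
  (residual A h)%:C%C * \det (A *m ctrmx A).
Proof.
have -> : ctrmx (col_mx h A) = row_mx (ctrmx h) (ctrmx A).
  by rewrite /ctrmx map_col_mx tr_col_mx.
have -> : col_mx h A *m row_mx (ctrmx h) (ctrmx A) =
    block_mx 1%:M (h *m ctrmx A *m invmx (A *m ctrmx A)) 0 1%:M *m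
    block_mx (h *m ortho_proj A *m ctrmx h) 0 (A *m ctrmx h) (A *m ctrmx A).
  rewrite mul_col_row mulmx_block !mul1mx !mul0mx !add0r mulmxKV//.
  congr block_mx.
  by rewrite mulmxBr mulmxBl mulmx1 !mulmxA subrK.
rewrite det_mulmx det_ublock det_lblock !det1 !mul1r residualE; congr (_ * _).
by rewrite det_mx11.
Qed.

(** Pythagoras: $h - cA$ is the sum of $hP$ and a combination of the rows of $A$, and these are
    orthogonal. *)
Lemma residual_min h (c : 'rV[C]_m) : residual A h <= sqnorm (h - c *m A).
Proof.
pose d := h *m ctrmx A *m invmx (A *m ctrmx A) - c.
have -> : h - c *m A = h *m ortho_proj A + d *m A.
  by rewrite mulmxBr mulmx1 mulmxBl !mulmxA addrA subrK.
rewrite sqnorm_orthoD ?lerDl ?sqnorm_ge0//.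
by rewrite ctrmxM mulmxA -(mulmxA h) -ortho_proj_herm -ctrmxM mulmx_ortho_proj
  ctrmx0 mulmx0 mul0mx.
Qed.

Lemma residual_attained h : exists c, sqnorm (h - c *m A) = residual A h.
Proof.
exists (h *m ctrmx A *m invmx (A *m ctrmx A)).
by rewrite /residual mulmxBr mulmx1 !mulmxA.
Qed.

End OrthoProj.

(** If $v A A^H = 0$ then $|vA|^2 = 0$, so the Gram matrix has no more left kernel than $A$. *)
Lemma gram_row_free m n (A : 'M[C]_(m, n)) :
  (A *m ctrmx A \in unitmx) = row_free A.
Proof.
apply/idP/idP => [uA|fA].
  rewrite /row_free eqn_leq rank_leq_row/= -[leqLHS](mxrank_unit uA).
  exact: mxrankM_maxl.
rewrite -row_free_unit -kermx_eq0; apply/eqP/row_matrixP => i.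
set v := row i _; rewrite row0; have vA : v *m (A *m ctrmx A) = 0.
  by apply/sub_kermxP; exact: row_sub.
apply/eqP; rewrite -(mulmx_free_eq0 v fA); apply/eqP/sqnorm_eq0/complexI.
by rewrite sqnormE ctrmxM mulmxA -(mulmxA v) vA mul0mx mxE.
Qed.

Lemma rowsub1_gram m n (s : 'I_m -> 'I_n) : injective s ->
  rowsub s 1%:M *m ctrmx (rowsub s 1%:M) = 1%:M :> 'M[C]_m.
Proof.
move=> s_inj; apply/matrixP => i j; rewrite mxE (bigD1 (s i))//= big1 => [|k ki].
  by rewrite ctrmxE !mxE eqxx mul1r addr0 conjc_nat (inj_eq s_inj) eq_sym.
by rewrite ctrmxE !mxE eq_sym (negbTE ki) mul0r.
Qed.

Lemma row_free_rowsub m n p (s : 'I_m -> 'I_n) (H : 'M[C]_(n, p)) :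
  injective s -> row_free H -> row_free (rowsub s H).
Proof.
move=> s_inj fH; rewrite -[H]mul1mx -mul_rowsub_mx /row_free mxrankMfree//.
by apply/row_freeP; exists (ctrmx (rowsub s 1%:M)); exact: rowsub1_gram.
Qed.

Lemma det_gram_rowsub n p (s : 'I_n -> 'I_n) (H : 'M[C]_(n, p)) : injective s ->
  \det (rowsub s H *m ctrmx (rowsub s H)) = \det (H *m ctrmx H).
Proof.
move=> s_inj; rewrite -[H in rowsub s H]mul1mx -mul_rowsub_mx ctrmxM.
rewrite mulmxA -(mulmxA _ H) !det_mulmx mulrAC -det_mulmx rowsub1_gram//.
by rewrite det1 mul1r.
Qed.

Lemma g2_residual n p (H : 'M[C]_(n, p)) (j : 'I_n) : row_free H ->
  g2 H j = residual (rowsub (lift j) H) (row j H).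
Proof.
move=> fH; set A := rowsub _ H.
have uA : A *m ctrmx A \in unitmx.
  by rewrite gram_row_free row_free_rowsub//; exact: lift_inj.
have cH (c : 'rV_n) : c 0 j = 0 -> c *m H = col' j c *m A.
  move=> cj; apply/rowP => l; rewrite !mxE.
  rewrite (bigD1_ord j)//= cj mul0r add0r.
  by apply: eq_bigr => k _; rewrite !mxE.
apply/eqP; rewrite eq_le; apply/andP; split; last first.
  apply: lb_le_inf => [|_ [c [cj ->]]]; last by rewrite cH//; exact: residual_min.
  by exists (sqnorm (row j H - 0 *m H)), 0; rewrite mxE.
have [c cE] := residual_attained A (row j H).
apply: ge_inf.
  by exists 0 => _ [d [_ ->]]; exact: sqnorm_ge0.
(* The optimal coefficients on the other rows, extended by 0 at [j]. *)
exists (\row_i (if unlift j i is Some k then c 0 k else 0)).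
rewrite mxE unlift_none; split=> //.
rewrite -cE cH; last by rewrite mxE unlift_none.
congr (sqnorm (_ - _ *m _)).
by apply/rowP => k; rewrite !mxE liftK.
Qed.

End Residual.

(** * High-SNR limit of the capacity gap *)

Section SumCapacity.
Variable R : realType.
Local Notation C := R[i].

(** Selection matrices merge the users' covariances into one block diagonal matrix of size $KN$, so
    that the rate bound can be proved for a general [Q]. *)
Definition user_sel K N (k : 'I_K) : 'M[C]_(N, K * N) :=
  \matrix_(a, i) (i == mxvec_index k a)%:R.

Lemma HblkE K N M (H : 'M[C]_(K * N, M)) k : Hblk H k = user_sel N k *m H.
Proof.
apply/matrixP => a j; rewrite !mxE (bigD1 (mxvec_index k a))//= !mxE eqxx mul1r.
by rewrite big1 ?addr0// => i /negbTE ik; rewrite mxE ik mul0r.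
Qed.

Lemma mxvec_index_eq K N (k k' : 'I_K) (a a' : 'I_N) :
  (mxvec_index k a == mxvec_index k' a') = (k == k') && (a == a').
Proof.
by rewrite /mxvec_index (inj_eq (@cast_ord_inj _ _ _)) (inj_eq enum_rank_inj)
  xpair_eqE.
Qed.

Lemma user_sel_gram K N (k : 'I_K) :
  user_sel N k *m ctrmx (user_sel N k) = 1%:M.
Proof.
apply/matrixP => a b; rewrite mxE (bigD1 (mxvec_index k a))//= big1 => [|i ik].
  by rewrite ctrmxE !mxE eqxx mul1r addr0 conjc_nat mxvec_index_eq eqxx.
by rewrite !mxE (negbTE ik) mul0r.
Qed.

Lemma sum_user_sel K N :
  \sum_(k < K) ctrmx (user_sel N k) *m user_sel N k = 1%:M.
Proof.
apply/matrixP => i j; rewrite summxE.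
case/mxvec_indexP: i => k a; rewrite (bigD1 k)//= big1 => [|l lk].
  rewrite addr0 !mxE (bigD1 a)//= big1 => [|b ba].
    by rewrite ctrmxE !mxE eqxx conjc_nat mul1r addr0 eq_sym.
  by rewrite ctrmxE !mxE mxvec_index_eq eqxx eq_sym (negbTE ba) conjc_nat mul0r.
rewrite mxE big1// => b _.
by rewrite ctrmxE !mxE mxvec_index_eq eq_sym (negbTE lk) conjc_nat mul0r.
Qed.

Lemma ln2_gt0 : 0 < ln 2 :> R.
Proof. by rewrite ln_gt0// ltr1n. Qed.

Lemma log2M (x y : R) : 0 < x -> 0 < y -> log2 (x * y) = log2 x + log2 y.
Proof. by move=> x0 y0; rewrite /log2 lnM ?posrE// mulrDl. Qed.

Lemma log2X n (x : R) : 0 < x -> log2 (x ^+ n) = n%:R * log2 x.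
Proof. by move=> x0; rewrite /log2 lnXn// -(mulr_natl (ln x)) mulrA. Qed.

Lemma log2_prod (I : finType) (F : I -> R) : (forall i, 0 < F i) ->
  log2 (\prod_i F i) = \sum_i log2 (F i).
Proof.
move=> F0.
apply: (@proj2 (0 < \prod_i F i)).
apply: (big_ind2 (fun x y => 0 < x /\ log2 x = y)) => [|x y x' y'|i _].
- by rewrite /log2 ln1 mul0r.
- by move=> [x0 <-] [x0' <-]; rewrite mulr_gt0// log2M.
- by split.
Qed.

Lemma le_log2 (x y : R) : 0 < x -> x <= y -> log2 x <= log2 y.
Proof.
move=> x0 xy; rewrite ler_pM2r ?invr_gt0 ?ln2_gt0// ler_ln ?posrE//.
exact: lt_le_trans xy.
Qed.

Section DirtyPaper.
Variables (K N M : nat) (H : 'M[C]_(K * N, M)).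
Hypothesis n0 : (0 < K * N)%N.
Hypothesis uW : H *m ctrmx H \in unitmx.
Let W := H *m ctrmx H.
Let n := (K * N)%N.

Definition block_diag (Q : 'I_K -> 'M[C]_N) : 'M[C]_(K * N) :=
  \sum_k ctrmx (user_sel N k) *m Q k *m user_sel N k.

Lemma block_diagE Q :
  \sum_k ctrmx (Hblk H k) *m Q k *m Hblk H k = ctrmx H *m block_diag Q *m H.
Proof.
rewrite mulmx_sumr mulmx_suml; apply: eq_bigr => k _.
by rewrite HblkE ctrmxM !mulmxA.
Qed.

Lemma block_diag_psd Q : (forall k, psd (Q k)) -> psd (block_diag Q).
Proof.
move=> pQ; apply: (big_ind (@psd R (K * N))); last first.
- by move=> k _; exact: psd_congr.
- exact: psdD.
- by rewrite -(scale0r 1%:M); exact: (psdZ (lexx 0) (psd1 R _)).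
Qed.

Lemma block_diag_tr Q : \tr (block_diag Q) = \sum_k \tr (Q k).
Proof.
rewrite raddf_sum; apply: eq_bigr => k _ /=.
by rewrite -mulmxA mxtrace_mulC -mulmxA user_sel_gram mulmx1.
Qed.

Lemma block_diag_scalar (c : R) :
  block_diag (fun=> c%:C%C *: 1%:M) = c%:C%C *: 1%:M.
Proof.
rewrite -[in RHS]sum_user_sel scaler_sumr; apply: eq_bigr => k _.
by rewrite -scalemxAr -scalemxAl mulmx1.
Qed.

Let D := complex.Re (\det W).
Let t := complex.Re (\tr (invmx W)).

(** $\det(I + H^H Q H) = \det W \det(W^{-1} + Q)$, and $W^{-1} + Q$ has trace at most $P + t$.
    Ignoring the block structure of the covariance costs nothing in the limit, because a multiple of
    the identity already reaches the bound there. *)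
Lemma DPC_rate_le (Q : 'M[C]_(K * N)) (P : R) : psd Q ->
  complex.Re (\tr Q) <= P ->
  log2 (complex.Re (\det (1%:M + ctrmx H *m Q *m H))) <=
  log2 D + n%:R * log2 ((P + t) / n%:R).
Proof.
move=> pQ trQ; have pW : psd W by exact: psd_gram.
have D0 : 0 < D by exact: psd_det_gt0.
have pV := psd_inv uW pW.
have pVQ := psdD pV pQ.
set v := complex.Re _.
(* Serves twice: it makes [log2] monotone at [v], and it excludes $P + t = 0$. *)
have v1 : 1 <= v.
  have [d [d0 _ _ /(_ 1)]] := psd_det (psd_congr H pQ).
  rewrite scale1r /v => -> /=; apply: (big_ind (fun x => 1 <= x)) => //.
    by move=> x y; exact: mulr_ege1.
  by move=> i _; rewrite mul1r lerDl.
have vE : v = complex.Re (\det (invmx W + Q)) * D.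
  rewrite /v -mulmxA det_1D_mulmxC -mulmxA -/W.
  have -> : 1%:M + Q *m W = (invmx W + Q) *m W by rewrite mulmxDl mulVmx.
  by rewrite det_mulmx (psd_det_real pVQ) (psd_det_real pW) -rmorphM.
have := psd_det_AGM n0 pVQ; rewrite [\tr _]raddfD [complex.Re (_ + _)]raddfD /=.
rewrite -/t => detle.
have t0 : 0 <= t by exact: psd_tr_ge0.
have {detle} vle : v <= D * ((P + t) / n%:R) ^+ n.
  rewrite vE mulrC ler_pM2l// (le_trans detle)//; apply: lerXn2r; rewrite ?nnegrE.
  - by rewrite divr_ge0 ?addr_ge0// psd_tr_ge0.
  - by rewrite divr_ge0 ?addr_ge0// (le_trans _ trQ)// psd_tr_ge0.
  - by rewrite ler_pM2r ?invr_gt0 ?ltr0n// addrC lerD2r.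
have v0 : 0 < v by exact: lt_le_trans v1.
rewrite (le_trans (le_log2 v0 vle))//.
have P0 : 0 < (P + t) / n%:R.
  rewrite lt_def divr_ge0 ?addr_ge0// ?(le_trans _ trQ)// ?psd_tr_ge0// andbT.
  apply/eqP => P0; move: vle; rewrite P0 expr0n gtn_eqF// mulr0.
  by rewrite leNgt v0.
have Pn0 : 0 < ((P + t) / n%:R) ^+ n by exact: exprn_gt0.
by rewrite (log2M D0 Pn0) (log2X _ P0).
Qed.

(** The lower bound comes from equal power $Q_k = (P/n) I$ and $\det(I + cW) \ge c^n \det W$. *)
Lemma C_DPC_bounds (P : R) : 0 < P ->
  log2 D + n%:R * log2 (P / n%:R) <= C_DPC H P <=
  log2 D + n%:R * log2 ((P + t) / n%:R).
Proof.
move=> P0; rewrite /C_DPC; set S := [set r | _].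
have D0 : 0 < D by apply: psd_det_gt0; [exact: psd_gram|exact: uW].
have Sub : ubound S (log2 D + n%:R * log2 ((P + t) / n%:R)).
  move=> _ [Q [pQ [trQ ->]]]; rewrite block_diagE; apply: DPC_rate_le.
    exact: block_diag_psd.
  by rewrite block_diag_tr; move: trQ; rewrite lecE => /andP[].
pose c := P / n%:R.
have c0 : 0 < c by rewrite divr_gt0// ltr0n.
have Sc : S (log2 (complex.Re (\det (1%:M + c%:C%C *: (H *m ctrmx H))))).
  exists (fun=> c%:C%C *: 1%:M); split; last split.
  - by move=> k; apply: psdZ; [exact: ltW|exact: psd1].
  - rewrite -block_diag_tr block_diag_scalar mxtraceZ mxtrace1.
    have <- : (c * (K * N)%:R)%:C%C = c%:C%C * (K * N)%:R.
      by rewrite rmorphM rmorph_nat.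
    have nz : (K * N)%:R != 0 :> R by rewrite pnatr_eq0 -lt0n.
    by rewrite /c (divfK nz) lexx.
  - rewrite block_diagE block_diag_scalar -scalemxAr mulmx1 -scalemxAl.
    by rewrite scalemxAl det_1D_mulmxC -scalemxAr.
have uS : has_ubound S by eexists; exact: Sub.
apply/andP; split; last by apply: ge_sup Sub; eexists; exact: Sc.
apply: le_trans (ub_le_sup uS Sc).
rewrite -(log2X _ c0) -(log2M D0 (exprn_gt0 _ c0)); apply: le_log2.
  by rewrite mulr_gt0 ?exprn_gt0.
by rewrite mulrC psd_det_1D_ge ?ltW//; exact: psd_gram.
Qed.

End DirtyPaper.

(** The scalar copy of the same argument, based on $1 + pg = g(p + g^{-1})$; equal power again gives
    the lower bound. *)
Lemma C_ZF_bounds n M (H : 'M[C]_(n, M)) (P : R) : (0 < n)%N ->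
  (forall j, 0 < g2 H j) -> 0 < P ->
  \sum_j log2 (g2 H j) + n%:R * log2 (P / n%:R) <= C_ZF H P <=
  \sum_j log2 (g2 H j) + n%:R * log2 ((P + \sum_j (g2 H j)^-1) / n%:R).
Proof.
move=> n0 g0 P0; rewrite /C_ZF; set S := [set r | _]; set t := \sum_j _^-1.
have nR0 : 0 < n%:R :> R by rewrite ltr0n.
have t0 : 0 <= t by apply: sumr_ge0 => j _; rewrite invr_ge0 ltW.
have Sub : ubound S (\sum_j log2 (g2 H j) + n%:R * log2 ((P + t) / n%:R)).
  move=> _ [p [p0 [pP ->]]].
  have -> : \sum_j log2 (1 + p j * g2 H j) =
      \sum_j log2 (g2 H j) + log2 (\prod_j (p j + (g2 H j)^-1)).
    rewrite log2_prod => [|j]; last by rewrite ltr_wpDl// invr_gt0.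
    rewrite -big_split/=; apply: eq_bigr => j _.
    rewrite -log2M ?ltr_wpDl ?invr_gt0//.
    by rewrite mulrDr mulfV ?gt_eqF// addrC mulrC.
  rewrite lerD2l -log2X; last by rewrite divr_gt0// ltr_wpDr.
  apply: le_log2.
    by apply: prodr_gt0 => j _; rewrite ltr_wpDl// invr_gt0.
  have AGM : \prod_j (p j + (g2 H j)^-1) <=
      (\sum_j (p j + (g2 H j)^-1) / n%:R) ^+ n.
    rewrite -mulr_suml -[X in _ / X%:R]card_ord -[X in _ ^+ X]card_ord.
    apply: (leif_AGM _).1 => j _.
    by rewrite addr_ge0// invr_ge0 ltW.
  apply: (le_trans AGM); apply: lerXn2r; rewrite ?nnegrE.
  - by apply: sumr_ge0 => j _; rewrite divr_ge0 ?addr_ge0// invr_ge0 ltW.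
  - by rewrite divr_ge0 ?addr_ge0// ltW.
  - by rewrite -mulr_suml ler_pM2r ?invr_gt0// big_split/= lerD2r.
have Sc : S (\sum_j log2 (1 + P / n%:R * g2 H j)).
  exists (fun=> P / n%:R); split; last split => //.
    by move=> j; rewrite divr_ge0 ?ltW.
  by rewrite sumr_const card_ord -(mulr_natr (P / n%:R)) divfK// gt_eqF.
have uS : has_ubound S by eexists; exact: Sub.
apply/andP; split; last by apply: ge_sup Sub; eexists; exact: Sc.
apply: le_trans (ub_le_sup uS Sc).
rewrite mulr_natl -[X in _ *+ X]card_ord -sumr_const -big_split/=.
apply: ler_sum => j _; have c0 : 0 < P / n%:R by rewrite divr_gt0.
rewrite addrC -log2M//; apply: le_log2; first by rewrite mulr_gt0.
by rewrite lerDr.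
Qed.

Lemma log2_ratio_le (n : nat) (P t : R) : (0 < n)%N -> 0 < P -> 0 <= t ->
  n%:R * log2 ((P + t) / n%:R) - n%:R * log2 (P / n%:R) <=
  (n%:R * t / ln 2) / P.
Proof.
move=> n0 P0 t0; have nR0 : 0 < n%:R :> R by rewrite ltr0n.
rewrite -mulrBr -!mulrA ler_pM2l//.
have Pt0 : 0 < P + t by rewrite ltr_wpDr.
rewrite !log2M ?invr_gt0// opprD addrACA subrr addr0.
rewrite /log2 -mulrBl mulrA mulrAC ler_pM2r ?invr_gt0 ?ln2_gt0//.
rewrite -ln_div ?posrE// mulrDl divff ?gt_eqF//.
by apply: le_ln1Dx; rewrite (lt_le_trans (ltrN10 _))// divr_ge0// ltW.
Qed.

Lemma cvgV0_pinfty : (fun P : R => P^-1) @ +oo%R --> (0 : R).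
Proof.
apply: ((@gtr0_cvgV0 _ _ _ _ (fun P : R => P) _).2 cvg_id).
exact: nbhs_pinfty_gt.
Qed.

(** The terms $n \log_2(P/n)$ cancel between the two pairs of bounds, and what remains is off by
    $O(1/P)$. *)
Lemma beta_gapE K N M (H : 'M[C]_(K * N, M)) : (0 < K * N)%N ->
  H *m ctrmx H \in unitmx -> (forall j, 0 < g2 H j) ->
  beta_gap H =
    log2 (complex.Re (\det (H *m ctrmx H))) - \sum_j log2 (g2 H j).
Proof.
move=> n0 uW g0; set W := H *m ctrmx H; set L := RHS.
pose t := complex.Re (\tr (invmx W)); pose u := \sum_j (g2 H j)^-1.
have t0 : 0 <= t by apply/psd_tr_ge0/psd_inv => //; exact: psd_gram.
have u0 : 0 <= u by apply: sumr_ge0 => j _; rewrite invr_ge0 ltW.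
pose cst_ x : R := (K * N)%:R * x / ln 2.
apply: cvg_lim => //.
apply: (@squeeze_cvgr _ _ _ _ (fun P => L - cst_ u / P) (fun P => L + cst_ t / P)).
- near=> P; have P0 : 0 < P by [].
  have /andP[] := C_DPC_bounds n0 uW P0; rewrite -/W -/t => d1 d2.
  have /andP[] := C_ZF_bounds n0 g0 P0; rewrite -/u => z1 z2.
  have ht := log2_ratio_le n0 P0 t0; have hu := log2_ratio_le n0 P0 u0.
  rewrite -/(cst_ t) in ht; rewrite -/(cst_ u) in hu.
  by rewrite /L; apply/andP; split; lra.
- rewrite -[X in _ --> X]subr0; apply: cvgB; first exact: cvg_cst.
  rewrite -(mulr0 (cst_ u)); apply: cvgM; first exact: cvg_cst.
  exact: cvgV0_pinfty.
- rewrite -[X in _ --> X]addr0; apply: cvgD; first exact: cvg_cst.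
  by rewrite -(mulr0 (cst_ t)); apply: cvgM; [exact: cvg_cst|exact: cvgV0_pinfty].
Unshelve. all: by end_near. Qed.

End SumCapacity.

(** * Gaussian integration by parts *)

Section GaussianIBP.
Variable R : realType.
Local Notation sigma := (Num.sqrt (2^-1) : R).
Local Notation leb := (@lebesgue_measure R).
Local Notation pdf := (normal_pdf 0 sigma).

Definition gauss : probability (measurableTypeR R) R := normal_prob 0 sigma.

Lemma gauss_sigma_gt0 : 0 < sigma.
Proof. by rewrite sqrtr_gt0 invr_gt0. Qed.

Lemma gauss_pdfE s : pdf s = normal_peak sigma * expR (- s ^+ 2).
Proof.
rewrite normal_pdfE ?gt_eqF ?gauss_sigma_gt0//; congr (_ * expR _).
by rewrite subr0 sqr_sqrtr ?invr_ge0// -mulr_natr mulVf ?divr1// pnatr_eq0.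
Qed.

Lemma measurable_pdf : measurable_fun setT pdf.
Proof. exact: measurable_normal_pdf. Qed.

(** A multiple of the standard normal density dominates: $1 + |s| \le 2 + s^2 \le 2 e^{s^2/2}$, and
    $e^{-s^2}$ is the square of $e^{-s^2/2}$. The constant [c] also corrects the ratio of the two
    peaks. *)
Lemma pdf_moment_integrable :
  leb.-integrable setT (fun s => ((1 + `|s|) * pdf s)%:E).
Proof.
pose c := 2 * normal_peak sigma / normal_peak (1 : R).
have p1 : 0 < normal_peak (1 : R) by rewrite normal_peak_gt0// oner_eq0.
have ps : 0 < normal_peak sigma.
  by rewrite normal_peak_gt0// gt_eqF// gauss_sigma_gt0.
have ic : leb.-integrable setT (fun s => c%:E * (normal_pdf 0 1 s)%:E)%E.
  by apply: integrableZl => //; exact: integrable_normal_pdf.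
apply: le_integrable ic => //.
  apply/measurable_EFinP/measurable_funM; last exact: measurable_pdf.
  by apply: measurable_funD => //; exact: measurable_normr.
move=> s _ /=; rewrite lee_fin.
have l0 : 0 <= (1 + `|s|) * pdf s by rewrite mulr_ge0 ?addr_ge0 ?normal_pdf_ge0.
rewrite (ger0_norm l0) [leRHS]ger0_norm; last first.
  by rewrite mulr_ge0 ?normal_pdf_ge0// divr_ge0 ?mulr_ge0// ltW.
rewrite gauss_pdfE normal_pdfE ?oner_eq0// /normal_fun subr0 expr1n.
have -> : c * (normal_peak 1 * expR (- s ^+ 2 / (1 *+ 2))) =
    normal_peak sigma * (2 * expR (- s ^+ 2 / (1 *+ 2))).
  by rewrite /c; field; rewrite gt_eqF.
rewrite mulrCA ler_pM2l//.
set u := - s ^+ 2 / (1 *+ 2); have -> : - s ^+ 2 = u + u by rewrite /u; field.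
rewrite expRD mulrA ler_pM2r ?expR_gt0//.
have -> : expR u = (expR (- u))^-1 by rewrite expRN invrK.
rewrite ler_pdivrMr ?expR_gt0//.
have := expR_ge1Dx (- u); rewrite /u.
have := real_normK (num_real s); have := normr_ge0 s; set a := `|s|.
rewrite /u => a0 <- h.
apply: le_trans (_ : 2 * (1 - - a ^+ 2 / (1 *+ 2)) <= _); last by rewrite ler_pM2l.
have -> : 2 * (1 - - a ^+ 2 / (1 *+ 2)) = 2 + a ^+ 2 by field.
have := sqr_ge0 (a - 1); rewrite sqrrB1; lra.
Qed.

Lemma ge0_integral_gauss (g : R -> \bar R) : measurable_fun setT g ->
  (forall s, 0 <= g s)%E ->
  (\int[gauss]_s g s = \int[leb]_s (g s * (pdf s)%:E))%E.
Proof.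
move=> mg g0; have dom := normal_prob_dominates (0 : R) sigma.
rewrite -(Radon_Nikodym_SigmaFinite.change_of_variables dom)//.
have iRN := Radon_Nikodym_SigmaFinite.f_integrable dom.
have mpdf : measurable_fun setT (fun s => (pdf s)%:E).
  by apply/measurable_EFinP; exact: measurable_pdf.
apply: ae_eq_integral => //.
- by apply: emeasurable_funM => //; exact: measurable_int iRN.
- exact: emeasurable_funM.
- apply: ae_eqe_mul2l; apply: integral_ae_eq => // E _ mE.
  by rewrite -Radon_Nikodym_SigmaFinite.f_integral.
Qed.

Lemma gauss_integrable_moment :
  gauss.-integrable setT (fun s => (1 + `|s|)%:E).
Proof.
have mf : measurable_fun setT (fun s : R => (1 + `|s|)%:E).
  apply/measurable_EFinP; apply: measurable_funD => //; exact: measurable_normr.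
apply/integrableP; split => //.
under eq_integral => s _ do rewrite gee0_abs ?lee_fin ?addr_ge0//.
rewrite ge0_integral_gauss; [|exact: mf|by move=> s; rewrite lee_fin addr_ge0].
have /integrableP[_] := pdf_moment_integrable; congr (_ < _)%E.
apply: eq_integral => s _.
by rewrite gee0_abs ?lee_fin ?mulr_ge0 ?addr_ge0 ?normal_pdf_ge0// EFinM.
Qed.

(** Linear growth is the class containing $s f(s)$ for bounded $f$. *)
Lemma integral_gauss (g : R -> R) C : measurable_fun setT g ->
  (forall s, `|g s| <= C * (1 + `|s|)) ->
  leb.-integrable setT (fun s => (g s * pdf s)%:E) /\
  (\int[gauss]_s (g s)%:E = \int[leb]_s (g s * pdf s)%:E)%E.
Proof.
move=> mg gC; have mgp : measurable_fun setT (fun s => (g s * pdf s)%:E).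
  by apply/measurable_EFinP/measurable_funM => //; exact: measurable_pdf.
split.
  have ic : leb.-integrable setT (fun s => C%:E * ((1 + `|s|) * pdf s)%:E)%E.
    by apply: integrableZl => //; exact: pdf_moment_integrable.
  apply: le_integrable ic => // s _ /=; rewrite lee_fin !normrM mulrA.
  rewrite (ger0_norm (normal_pdf_ge0 _ _ _)) ler_wpM2r ?normal_pdf_ge0//.
  by rewrite (le_trans (gC s))// -normrM ler_norm.
have mg' : measurable_fun setT (EFin \o g) by exact/measurable_EFinP.
rewrite [LHS]integralE [RHS]integralE.
rewrite (ge0_integral_gauss (measurable_funepos mg'))//.
rewrite (ge0_integral_gauss (measurable_funeneg mg'))//.
congr (_ - _)%E; apply: eq_integral => s _.
  rewrite !funeposE /= -!EFin_max -EFinM; congr EFin.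
  by rewrite maxr_pMl ?normal_pdf_ge0// mul0r.
rewrite !funenegE /= -!EFin_max -EFinM; congr EFin.
by rewrite maxr_pMl ?normal_pdf_ge0// mul0r mulNr.
Qed.

(* Over all of R the integral of (f pdf)' vanishes, and pdf' s = - 2 s pdf s. *)
Lemma gauss_ibp (f f' : R -> R) (C : R) :
  (forall s : R, is_derive s 1 f (f' s)) -> continuous f' ->
  (forall s, `|f s| <= C) -> (forall s, `|f' s| <= C) ->
  (\int[gauss]_s (s * f s)%:E = \int[gauss]_s (f' s / 2)%:E)%E.
Proof.
move=> df cf' fC f'C.
have cf : continuous f.
  by move=> s; apply/differentiable_continuous/derivable1_diffP; have [] := df s.
have mf : measurable_fun setT f by exact: continuous_measurable_fun.
have mf' : measurable_fun setT f' by exact: continuous_measurable_fun.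
have C0 : 0 <= C by exact: le_trans (normr_ge0 _) (fC 0).
pose g s := s * f s; pose h s := f' s / 2.
have mg : measurable_fun setT g by exact: measurable_funM.
have mh : measurable_fun setT h by exact: measurable_funM.
have gC s : `|g s| <= C * (1 + `|s|).
  by rewrite normrM mulrC ler_pM// lerDr.
have hC s : `|h s| <= C * (1 + `|s|).
  rewrite normrM (@ger0_norm _ 2^-1)// ler_pM// (@le_trans _ _ 1)// ?lerDl//.
  by rewrite invf_le1// ler1n.
have [ig ->] := integral_gauss mg gC; have [ih ->] := integral_gauss mh hC.
(* The derivative of [f s * pdf s]; its integral is twice the difference of the two sides. *)
pose k s := (f' s - 2 * s * f s) * pdf s.
have kE s : ((k s)%:E = 2%:E * ((h s * pdf s)%:E - (g s * pdf s)%:E))%E.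
  by rewrite -EFinB -EFinM; congr EFin; rewrite /k /h /g; field.
have ik : leb.-integrable setT (EFin \o k).
  have i2 : leb.-integrable setT
      (fun s => 2%:E * ((h s * pdf s)%:E - (g s * pdf s)%:E))%E.
    by apply: integrableZl => //; exact: integrableB.
  by apply: eq_integrable i2 => // s _; rewrite /= kE.
suff k0 : (\int[leb]_s (k s)%:E = 0)%E.
  move: k0; under eq_integral do rewrite kE.
  rewrite integralZl//; last exact: integrableB.
  rewrite integralB//.
  have fh := integrable_fin_num measurableT ih.
  have fg := integrable_fin_num measurableT ig.
  rewrite -(fineK fh) -(fineK fg) -EFinB -EFinM => -[] /eqP.
  by rewrite mulf_eq0 pnatr_eq0/= subr_eq0 => /eqP ->.
pose F s := f s * pdf s.
pose c := normal_peak sigma.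
have c0 : 0 <= c by exact: normal_peak_ge0.
have FE : F = (fun s => f s * (c * expR (- s ^+ 2))).
  by apply/funext => s; rewrite /F gauss_pdfE.
have dF (s : R) : is_derive s 1 F (k s).
  have dsq : is_derive s 1 (fun s : R => - s ^+ 2) (- (2 * s)).
    by apply: is_derive_eq; rewrite /GRing.scale/=; ring.
  have dexp := @is_derive1_comp R expR (fun s => - s ^+ 2) s _ _
    (is_derive_expR _) dsq.
  rewrite FE; have := is_deriveM (df s) (is_deriveM (is_derive_cst c s 1) dexp).
  move=> h'; apply: (is_derive_eq h'); rewrite /k gauss_pdfE -/c /GRing.scale/=.
  by rewrite !fctE /=; ring.
have cF : continuous F.
  by move=> s; apply/differentiable_continuous/derivable1_diffP; have [] := dF s.
have ck : continuous k.
  move=> s; apply: cvgM; last by apply: continuous_normal_pdf; rewrite gt_eqF// gauss_sigma_gt0.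
  apply: cvgB; first exact: cf'.
  by apply: cvgM; [apply: cvgM; [exact: cvg_cst|exact: cvg_id]|exact: cf].
(* Truncation to symmetric intervals, where the integral is a difference of boundary values that
   tend to 0; the shift by one keeps the interval nondegenerate. *)
pose u (n : nat) := ((k \_ `[- n.+1%:R, n.+1%:R]) : R -> R).
have uE n : (\int[leb]_s (u n s)%:E = (F n.+1%:R - F (- n.+1%:R))%:E)%E.
  transitivity (\int[leb]_(s in `[(- n.+1%:R)%R, n.+1%:R]) (k s)%:E)%E.
    rewrite [RHS]integral_mkcond; apply: eq_integral => s _.
    by rewrite restrict_EFin.
  rewrite EFinB; apply: continuous_FTC2.
  - by rewrite (@lt_trans _ _ 0)// oppr_lt0.
  - exact: continuous_subspaceT.
  - split; [|exact/cvg_at_right_filter/cF|exact/cvg_at_left_filter/cF].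
    by move=> s _; have [] := dF s.
  - by move=> s _; rewrite derive1E; have [_ ->] := dF s.
have ucvg s : (u n s)%:E @[n --> \oo] --> (k s)%:E.
  apply: cvg_near_cst; exists (Num.truncn `|s|) => // n /= sn.
  congr EFin; rewrite /u patchE; case: ifPn => // /negP[]; rewrite inE/= in_itv/=.
  by rewrite -ler_norml ltW// -truncn_le_nat.
have mk : measurable_fun setT k by exact: continuous_measurable_fun.
have mu n : measurable_fun setT (fun s => (u n s)%:E).
  apply/measurable_EFinP; apply: (measurable_restrictT _ _).1 => //.
  exact: measurable_funTS.
have uk n s : (`|(u n s)%:E| <= `|(k s)%:E|)%E.
  by rewrite lee_fin /u patchE; case: ifPn => // _; rewrite normr0.
have [||||| _ _ ku] := @dominated_convergence _ _ _ leb setT measurableT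
  (fun n s => (u n s)%:E) (EFin \o k) (fun s => `|(k s)%:E|%E).
- exact: mu.
- exact/measurable_EFinP.
- by apply: aeW => s _; exact: ucvg.
- exact: integrable_abse.
- by apply: aeW => s n _; exact: uk.
apply: (cvg_unique _ ku) => //=.
under eq_fun do rewrite uE.
apply: cvg_EFin; first exact: nearW.
have gn : gauss_fun (n.+1%:R : R) @[n --> \oo] --> (0 : R).
  apply: (cvg_comp (fun n : nat => n.+1%:R : R)); last exact: cvg_gauss_fun.
  by rewrite (cvg_shiftS (fun n : nat => n%:R : R)); exact: cvgr_idn.
apply/norm_cvg0P.
apply: (@squeeze_cvgr _ _ _ _ (fun=> 0) (fun n => 2 * C * c * gauss_fun n.+1%:R)).
- apply: nearW => n /=; rewrite normr_ge0/= (le_trans (ler_normB _ _))//.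
  have Fle s : `|F s| <= C * c * gauss_fun s.
    rewrite /F gauss_pdfE normrM -mulrA ler_pM//.
    by rewrite ger0_norm// mulr_ge0// expR_ge0.
  rewrite (le_trans (lerD (Fle _) (Fle _)))// /gauss_fun sqrrN.
  by rewrite -mulr2n -[leLHS]mulr_natl !mulrA.
- exact: cvg_cst.
- by rewrite -[X in _ --> X](mulr0 (2 * C * c)); apply: cvgM => //; exact: cvg_cst.
Qed.

End GaussianIBP.

(** * Integration by parts for the rational test functions *)

Section RationalStein.
Variable R : realType.

Lemma measurable_inv : measurable_fun setT (fun x : R => x^-1).
Proof.
rewrite -(setUv [set (0 : R)]); apply/measurable_funU => //.
  exact: measurableC.
split; first exact: measurable_fun_set1.
apply: open_continuous_measurable_fun.
  by apply: closed_openC; exact: closed_eq.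
by move=> x; rewrite inE/= => /eqP x0; exact: inv_continuous.
Qed.

(** $|y| \le 1 + y^2 \le 1 + Q \le (1/a + 1/b)(a + bQ)$. A bound uniform in [y] and [Q] is what
    integration by parts asks for. *)
Lemma ratio_le (a b y Q : R) : 0 < a -> 0 < b -> y ^+ 2 <= Q ->
  `|y / (a + b * Q)| <= a^-1 + b^-1.
Proof.
move=> a0 b0 yQ; have Q0 : 0 <= Q by exact: le_trans (sqr_ge0 y) yQ.
have D0 : 0 < a + b * Q by rewrite ltr_wpDr// mulr_ge0// ltW.
rewrite normrM (@ger0_norm _ _^-1) ?invr_ge0 ?(ltW D0)// ler_pdivrMr//.
have y1 : `|y| <= 1 + Q.
  have := sqr_ge0 (`|y| - 1); rewrite sqrrB1 real_normK ?num_real// => h.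
  have := normr_ge0 y; lra.
rewrite (le_trans y1)// mulrDl !mulrDr mulVf ?gt_eqF// mulKf ?gt_eqF//.
have : 0 <= a^-1 * (b * Q) by rewrite !mulr_ge0 ?invr_ge0 ?(ltW a0) ?(ltW b0).
have : 0 <= b^-1 * a by rewrite mulr_ge0 ?invr_ge0 ?(ltW a0) ?(ltW b0).
lra.
Qed.

Lemma ratio_deriv_le (a b p y Q : R) : 0 < a -> 0 < b -> 0 <= p <= 1 ->
  y ^+ 2 <= Q ->
  `|p / (a + b * Q) - 2 * b * y ^+ 2 / (a + b * Q) ^+ 2| <= 2 / a.
Proof.
move=> a0 b0 /andP[p0 p1] yQ; have Q0 : 0 <= Q by exact: le_trans (sqr_ge0 y) yQ.
have bQ0 : 0 <= b * Q by rewrite mulr_ge0// ltW.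
have D0 : 0 < a + b * Q by rewrite ltr_wpDr.
have aD : (a + b * Q)^-1 <= a^-1 by rewrite lef_pV2 ?posrE// lerDl.
have Dp : 0 < (a + b * Q)^-1 by rewrite invr_gt0.
have h1 : 0 <= p / (a + b * Q) <= a^-1.
  rewrite divr_ge0 ?(ltW D0)//= (le_trans _ aD)// ler_piMl// ltW//.
have h2 : 0 <= b * y ^+ 2 / (a + b * Q) ^+ 2 <= a^-1.
  have by0 : 0 <= b * y ^+ 2 by apply: mulr_ge0; [exact: ltW|exact: sqr_ge0].
  rewrite (divr_ge0 by0) ?sqr_ge0//=.
  rewrite (le_trans _ aD)// [(a + _) ^+ 2]expr2 invfM mulrA; apply: ler_piMl; first exact: ltW.
  rewrite ler_pdivrMr// mul1r.
  have : b * y ^+ 2 <= b * Q by rewrite ler_pM2l.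
  lra.
have a1 : 0 < a^-1 by rewrite invr_gt0.
by rewrite ler_norml; move: h1 h2 => /andP[? ?] /andP[? ?]; apply/andP; split; lra.
Qed.

(** Here [s] is one real coordinate of the row and the others are frozen: $ps^2 + 2qs + r$ is the
    quadratic form and $ps + q$ the matching coordinate of the projected vector. The assumed
    inequality says that one coordinate of a vector is at most its norm. *)
Lemma gauss_ibp_ratio (a b p q r : R) : 0 < a -> 0 < b -> 0 <= p <= 1 ->
  (forall s, (p * s + q) ^+ 2 <= p * s ^+ 2 + 2 * q * s + r) ->
  let D s := a + b * (p * s ^+ 2 + 2 * q * s + r) in
  (\int[@gauss R]_s (s * ((p * s + q) / D s))%:E =
   \int[@gauss R]_s ((p / D s - 2 * b * (p * s + q) ^+ 2 / D s ^+ 2) / 2)%:E)%E.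
Proof.
move=> a0 b0 p01 yQ D.
have D0 s : D s != 0.
  rewrite gt_eqF// ltr_wpDr// mulr_ge0 ?(ltW b0)//.
  exact: le_trans (sqr_ge0 _) (yQ s).
have dD (s : R) : is_derive s 1 D (b * (2 * (p * s + q))).
  by rewrite /D; apply: is_derive_eq; rewrite /GRing.scale/=; ring.
have dy (s : R) : is_derive s 1 (fun s => p * s + q) p.
  by apply: is_derive_eq; rewrite /GRing.scale/=; ring.
have cD : continuous D.
  by move=> s; apply/differentiable_continuous/derivable1_diffP; have [] := dD s.
have cy : continuous (fun s => p * s + q).
  by move=> s; apply/differentiable_continuous/derivable1_diffP; have [] := dy s.
have cDV : continuous (fun s => (D s)^-1) by move=> s; apply: cvgV; [exact: D0|exact: cD].
pose f' s := p / D s - 2 * b * (p * s + q) ^+ 2 / D s ^+ 2.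
apply: (@gauss_ibp R (fun s => (p * s + q) / D s) f' (2 / a + b^-1)).
- move=> s; have := is_deriveM (dy s) (is_deriveV (D0 s) (dD s)).
  move=> h; apply: (is_derive_eq h); rewrite /f' /GRing.scale/=.
  by field; rewrite D0.
- have -> : f' = (fun s => p * (D s)^-1 -
      2 * b * ((p * s + q) * (p * s + q)) * ((D s)^-1 * (D s)^-1)).
    by apply/funext => s; rewrite /f'; field; rewrite D0.
  move=> s; apply: cvgB; first by apply: cvgM; [exact: cvg_cst|exact: cDV].
  apply: cvgM; last by apply: cvgM; exact: cDV.
  by apply: cvgM; [exact: cvg_cst|apply: cvgM; exact: cy].
- move=> s; apply: le_trans (ratio_le a0 b0 (yQ s)) _.
  by rewrite lerD2r ler_peMl ?invr_ge0 ?(ltW a0)// ler1n.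
- move=> s; apply: le_trans (ratio_deriv_le a0 b0 p01 (yQ s)) _.
  by rewrite lerDl invr_ge0 ltW.
Qed.

End RationalStein.

(** * Independence *)

Section Disintegration.
Context d d' (T : measurableType d) (S : measurableType d') (R : realType).
Variables (Pr : probability T R) (mu : probability (measurableTypeR R) R).
Variables (X : T -> measurableTypeR R) (Y : T -> S).
Hypotheses (mX : measurable_fun setT X) (mY : measurable_fun setT Y).
Hypothesis XY : forall (B : set R) (A : set S), measurable B -> measurable A ->
  Pr (X @^-1` B `&` Y @^-1` A) = (mu B * Pr (Y @^-1` A))%E.

Let X' : {mfun T >-> measurableTypeR R} :=
  HB.pack X (isMeasurableFun.Build _ _ _ _ X mX).
Let Y' : {mfun T >-> S} := HB.pack Y (isMeasurableFun.Build _ _ _ _ Y mY).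

Let mXY : measurable_fun setT (fun w => (X w, Y w) : measurableTypeR R * S).
Proof. exact: measurable_fun_pair. Qed.

Let XY' : {mfun T >-> (measurableTypeR R * S)%type} :=
  HB.pack (fun w => (X w, Y w) : measurableTypeR R * S)
    (isMeasurableFun.Build _ _ _ _ _ mXY).

Lemma indep_law (A : set (measurableTypeR R * S)) : measurable A ->
  (mu \x distribution Pr Y')%E A = distribution Pr XY' A.
Proof.
apply: product_measure_unique => B C mB mC.
by rewrite /distribution /pushforward -XY.
Qed.

Lemma law_fst (B : set R) : measurable B -> mu B = distribution Pr X' B.
Proof.
move=> mB; have := XY mB measurableT.
by rewrite preimage_setT setIT probability_setT mule1.
Qed.

(** Fubini for the joint law of [X] and [Y], which is a product measure. *)
Lemma indep_integral (F : R * S -> \bar R) :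
  measurable_fun (setT : set (measurableTypeR R * S)) F ->
  Pr.-integrable setT (fun w => F (X w, Y w)) ->
  (\int[Pr]_w F (X w, Y w) =
   \int[distribution Pr Y']_y \int[mu]_s F (s, y))%E.
Proof.
move=> mF iF.
have iJ : (distribution Pr XY').-integrable setT F.
  by apply: (integrable_pushforward mXY mF).
have iP : (mu \x distribution Pr Y')%E.-integrable setT F.
  apply/integrableP; split => //.
  rewrite (eq_measure_integral (distribution Pr XY')); last first.
    by move=> A mA _; exact: indep_law.
  by have /integrableP[] := iJ.
rewrite (integral21_prod_meas1 iP).
rewrite (eq_measure_integral (distribution Pr XY')); last first.
  by move=> A mA _; exact: indep_law.
by rewrite (integral_pushforward mXY mF).
Qed.

Lemma law_integrable (g : R -> R) : measurable_fun setT g ->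
  mu.-integrable setT (EFin \o g) -> Pr.-integrable setT (EFin \o g \o X).
Proof.
move=> mg /integrableP[_ ig]; apply/integrableP; split.
  by apply/measurable_EFinP; exact: measurableT_comp.
have me : measurable_fun setT (fun s => `|(g s)%:E|%E).
  by apply: measurableT_comp => //; exact/measurable_EFinP.
move: ig; rewrite (eq_measure_integral (distribution Pr X')); last first.
  by move=> A mA _; exact: law_fst.
by rewrite ge0_integral_pushforward.
Qed.

(** Carries an identity known for every frozen value of [Y] over to [Pr]; growth measured in [X]
    alone supplies the integrability. *)
Lemma indep_exchange (F1 F2 : R * S -> R) (C : R) :
  measurable_fun (setT : set (measurableTypeR R * S)) F1 ->
  measurable_fun (setT : set (measurableTypeR R * S)) F2 ->
  mu.-integrable setT (fun s => (1 + `|s|)%:E) ->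
  (forall z, `|F1 z| <= C * (1 + `|z.1|)) ->
  (forall z, `|F2 z| <= C * (1 + `|z.1|)) ->
  (forall y, \int[mu]_s (F1 (s, y))%:E = \int[mu]_s (F2 (s, y))%:E)%E ->
  [/\ Pr.-integrable setT (fun w => (F1 (X w, Y w))%:E),
      Pr.-integrable setT (fun w => (F2 (X w, Y w))%:E) &
      (\int[Pr]_w (F1 (X w, Y w))%:E = \int[Pr]_w (F2 (X w, Y w))%:E)%E].
Proof.
move=> mF1 mF2 imu F1C F2C F12.
have mabs : measurable_fun setT (fun s : R => 1 + `|s|).
  by apply: measurable_funD => //; exact: measurable_normr.
have iX : Pr.-integrable setT (fun w => C%:E * (1 + `|X w|)%:E)%E.
  by apply: integrableZl => //; exact: (law_integrable mabs).
have iF (F : R * S -> R) : measurable_fun (setT : set (measurableTypeR R * S)) F ->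
    (forall z : R * S, `|F z| <= C * (1 + `|z.1|)) ->
    Pr.-integrable setT (fun w => (F (X w, Y w))%:E).
  move=> mF FC; apply: le_integrable iX => //.
    apply/measurable_EFinP; exact: (measurableT_comp mF mXY).
  by move=> w _ /=; rewrite lee_fin (le_trans (FC _))// ler_norm.
split; [exact: iF|exact: iF|].
rewrite (indep_integral (F := EFin \o F1)) ?(indep_integral (F := EFin \o F2));
  [|by apply/measurable_EFinP|exact: iF|by apply/measurable_EFinP|exact: iF].
by apply: eq_integral => y _; exact: F12.
Qed.

End Disintegration.

(** * Quadratic forms of real orthogonal projections *)

Section QuadraticForm.
Variables (R : realType) (J : finType) (p : J -> J -> R).

Definition lin_form (y : J -> R) t := \sum_u p t u * y u.
Definition quad_form (y : J -> R) := \sum_t y t * lin_form y t.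
Definition upd (y : J -> R) t s := fun u => if u == t then s else y u.

Lemma upd_id y t : upd y t (y t) = y.
Proof. by apply/funext => u; rewrite /upd; case: eqP => [->|]. Qed.

Lemma lin_form_upd y t s u :
  lin_form (upd y t s) u = p u t * s + lin_form (upd y t 0) u.
Proof.
rewrite /lin_form (bigD1 t)//= [in RHS](bigD1 t)//= /upd !eqxx mulr0 add0r.
by congr (_ + _); apply: eq_bigr => v /negbTE ->.
Qed.

Hypothesis p_sym : forall t u, p t u = p u t.
Hypothesis p_idem : forall t u, \sum_v p t v * p v u = p t u.

Lemma quad_form_upd y t s : quad_form (upd y t s) =
  p t t * s ^+ 2 + 2 * lin_form (upd y t 0) t * s + quad_form (upd y t 0).
Proof.
rewrite /quad_form; set q := lin_form _ t.
transitivity (\sum_u (upd y t 0 u * lin_form (upd y t 0) u +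
    s * (p t u * upd y t 0 u) + (u == t)%:R * (s * (p t t * s + q)))).
  apply: eq_bigr => u _; rewrite lin_form_upd.
  have -> : upd y t s u = upd y t 0 u + (u == t)%:R * s.
    by rewrite /upd; case: eqP; rewrite ?mul1r ?add0r ?mul0r ?addr0.
  rewrite (p_sym u t); set z := upd y t 0.
  by case: (eqVneq u t) => [->|_]; rewrite /q /=; ring.
rewrite !big_split/= -mulr_sumr -/(lin_form _ t) -/q -mulr_suml.
have -> : \sum_u (u == t)%:R = 1 :> R.
  by rewrite (bigD1 t)//= eqxx big1 ?addr0// => u /negbTE ->.
by ring.
Qed.

(** $|Py|^2 = y^T P^T P y = y^T P y$. *)
Lemma sum_lin_form_sqr y : \sum_t lin_form y t ^+ 2 = quad_form y.
Proof.
transitivity (\sum_t \sum_u \sum_v y u * (p u t * p t v) * y v).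
  apply: eq_bigr => t _; rewrite expr2 /lin_form big_distrl/=.
  apply: eq_bigr => u _; rewrite big_distrr/=; apply: eq_bigr => v _.
  by rewrite (p_sym u t); ring.
rewrite exchange_big/=; apply: eq_bigr => u _.
rewrite exchange_big/= big_distrr/=; apply: eq_bigr => v _.
by rewrite -p_idem !mulr_suml mulr_sumr; apply: eq_bigr => t _; ring.
Qed.

Lemma lin_form_sqr_le y t : lin_form y t ^+ 2 <= quad_form y.
Proof.
rewrite -sum_lin_form_sqr (bigD1 t)//= lerDl.
by apply: sumr_ge0 => u _; exact: sqr_ge0.
Qed.

Lemma quad_form_ge0 y : 0 <= quad_form y.
Proof. by rewrite -sum_lin_form_sqr sumr_ge0// => t _; exact: sqr_ge0. Qed.

(** $p_{tt}^2 \le \sum_v p_{tv}^2 = p_{tt}$. *)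
Lemma idem_diag t : 0 <= p t t <= 1.
Proof.
have pp : p t t ^+ 2 <= p t t.
  rewrite -[leRHS]p_idem (bigD1 t)//= -expr2 lerDl sumr_ge0// => u _.
  by rewrite (p_sym u t) -expr2 sqr_ge0.
have p0 : 0 <= p t t by exact: le_trans (sqr_ge0 _) pp.
rewrite p0/= leNgt; apply/negP => p1; move: pp; rewrite leNgt expr2.
by rewrite ltr_pMl ?p1// (lt_trans ltr01).
Qed.

End QuadraticForm.

(** * Sigma-algebras generated by sets of coordinates *)

Section GaussianFamily.
Context d (T : measurableType d) (R : realType) (Pr : probability T R).
Variables (I : finType) (x : I -> T -> R).
Hypothesis mx : forall t, measurable_fun setT (x t).
Hypothesis x_iid : forall B : I -> set R, (forall t, measurable (B t)) ->
  Pr (\bigcap_(t in setT) (x t @^-1` B t)) = (\prod_t gauss R (B t))%E.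

(** A pi-system generating the sigma-algebra of the coordinates in [D]. Freezing these coordinates
    is expressed by giving [T] this smaller sigma-algebra and taking the identity as [Y], instead of
    splitting [T] as a product. *)
Definition cylinders (D : pred I) : set (set T) :=
  [set A | exists B : I -> set R, [/\ forall u, measurable (B u),
     forall u, ~~ D u -> B u = setT & A = \bigcap_(u in setT) (x u @^-1` B u)]].

Lemma cylinders_measurable D : cylinders D `<=` measurable.
Proof.
move=> A [B [mB _ ->]]; apply: fin_bigcap_measurable => // u _.
by rewrite -[X in measurable X]setTI; exact: mx.
Qed.

Lemma cylindersI D : setI_closed (cylinders D).
Proof.
move=> A A' [B [mB BT ->]] [B' [mB' BT' ->]].
exists (fun u => B u `&` B' u); split.
- by move=> u; exact: measurableI.
- by move=> u Du; rewrite BT// BT'// setIT.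
- by rewrite -bigcapI; apply: eq_bigcapr.
Qed.

Lemma cylindersT D : cylinders D setT.
Proof.
exists (fun=> setT); split => //.
by apply/seteqP; split.
Qed.

Lemma measurable_cylinders (D D' : pred I) d' (S : measurableType d') (f : T -> S) :
  {subset D <= D'} ->
  measurable_fun (setT : set (g_sigma_algebraType (cylinders D))) f ->
  measurable_fun (setT : set (g_sigma_algebraType (cylinders D'))) f.
Proof.
move=> DD' mf _ B mB; have := mf measurableT B mB; apply: sub_sigma_algebra2.
move=> A [C [mC CT ->]]; exists C; split => // u Du.
by apply: CT; apply: contra Du; exact: DD'.
Qed.

Lemma measurable_coord (D : pred I) u : D u ->
  measurable_fun (setT : set (g_sigma_algebraType (cylinders D))) (x u).
Proof.
move=> Du _ B mB; rewrite setTI; apply: sub_sigma_algebra.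
exists (fun v => if v == u then B else setT); split.
- by move=> v; case: ifP.
- by move=> v Dv; case: eqP Dv => // ->; rewrite Du.
- apply/seteqP; split => [w /= xB v _|w /(_ u Logic.I)]; last by rewrite /= eqxx.
  by rewrite /=; case: eqP => // ->.
Qed.

Lemma measurable_id_cylinders D : measurable_fun (setT : set T)
  (idfun : T -> g_sigma_algebraType (cylinders D)).
Proof.
move=> _ A mA; rewrite setTI preimage_id; move: A mA.
exact: smallest_sub (@sigma_algebra_measurable _ T) (@cylinders_measurable D).
Qed.

(** Both sides are finite measures in [A] and agree on cylinders, where imposing [B] at [t] only
    replaces a trivial factor of the product. *)
Lemma cylinders_indep (D : pred I) t (B : set R) (A : set T) : ~~ D t ->
  measurable B -> measurable (A : set (g_sigma_algebraType (cylinders D))) ->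
  Pr (x t @^-1` B `&` A) = (gauss R B * Pr A)%E.
Proof.
move=> Dt mB mA.
have mxB : measurable (x t @^-1` B).
  by rewrite -[X in measurable X]setTI; exact: mx.
have gB : gauss R B \is a fin_num by exact: fin_num_measure.
have gB0 : 0 <= fine (gauss R B) by exact: fine_ge0.
pose m1 : {measure set T -> \bar R} := mrestr Pr mxB.
pose m2 : {measure set T -> \bar R} := mscale (NngNum gB0) Pr.
have -> : (gauss R B * Pr A = m2 A)%E by rewrite /m2/= /mscale/= fineK.
have -> : Pr (x t @^-1` B `&` A) = m1 A by rewrite /m1/= /mrestr setIC.
apply: (@g_sigma_algebra_measure_unique _ _ _ (cylinders D) _ (fun=> setT)
  _ _ m1 m2 _ _ _ _ mA).
- exact: cylinders_measurable.
- by move=> _; exact: cylindersT.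
- by rewrite bigcup_const.
- exact: cylindersI.
- move=> _ [C [mC CT ->]]; rewrite /m1/= /mrestr /m2/= /mscale/= fineK//.
  pose C' u := if u == t then B else C u.
  have -> : \bigcap_(u in setT) (x u @^-1` C u) `&` x t @^-1` B =
      \bigcap_(u in setT) (x u @^-1` C' u).
    apply/seteqP; split => [w [xC xB] u _|w xC].
      by rewrite /C' /=; case: eqP => [->//|_]; exact: xC.
    split; last by have := xC t Logic.I; rewrite /C' /= eqxx.
    move=> u _; have := xC u Logic.I; rewrite /C' /=.
    by case: eqP => // -> _; rewrite CT.
  rewrite !x_iid//; last by move=> u; rewrite /C'; case: ifP.
  rewrite (bigD1 t)//= [in RHS](bigD1 t)//= {1}/C' eqxx CT// probability_setT.
  by rewrite mul1e; congr (_ * _)%E; apply: eq_bigr => u /negbTE ut; rewrite /C' ut.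
- by move=> _; rewrite /m1/= /mrestr setTI (le_lt_trans (probability_le1 _ _))// ltry.
Qed.

End GaussianFamily.

(** * Moments of Gaussian quadratic forms *)

Section GaussianQuadraticForm.
Context d (T : measurableType d) (R : realType) (Pr : probability T R).
Variables (I J : finType) (x : I -> T -> R) (iota : J -> I).
Hypothesis mx : forall t, measurable_fun setT (x t).
Hypothesis x_iid : forall B : I -> set R, (forall t, measurable (B t)) ->
  Pr (\bigcap_(t in setT) (x t @^-1` B t)) = (\prod_t gauss R (B t))%E.
Hypothesis iota_inj : injective iota.

(** The coordinates that do not belong to the row under study; letting [p] depend on them alone
    encodes conditioning on the other rows. *)
Let outside : pred I := fun u => u \notin codom iota.

Variable p : T -> J -> J -> R.
Hypothesis mp : forall t u, measurable_fun
  (setT : set (g_sigma_algebraType (cylinders x outside))) (fun w => p w t u).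
Hypothesis p_sym : forall w t u, p w t u = p w u t.
Hypothesis p_idem : forall w t u, \sum_v p w t v * p w v u = p w t u.

Let y w t := x (iota t) w.

Definition gquad w := quad_form (p w) (y w).

Lemma gquad_ge0 w : 0 <= gquad w.
Proof. exact: quad_form_ge0. Qed.

Lemma measurable_p t u : measurable_fun setT (fun w => p w t u).
Proof.
have h := measurableT_comp (mp t u) (measurable_id_cylinders mx (D := outside)).
exact: h.
Qed.

Lemma measurable_gquad : measurable_fun setT gquad.
Proof.
apply: measurable_sum => t; apply: measurable_funM; first exact: mx.
apply: measurable_sum => u; apply: measurable_funM; last exact: mx.
exact: measurable_p.
Qed.

Let lin w t := lin_form (p w) (y w) t.

Lemma gauss_stein_coord (a b : R) t : 0 < a -> 0 < b ->
  [/\ Pr.-integrable setT (fun w => (y w t * (lin w t / (a + b * gquad w)))%:E),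
      Pr.-integrable setT (fun w => ((p w t t / (a + b * gquad w) -
        2 * b * lin w t ^+ 2 / (a + b * gquad w) ^+ 2) / 2)%:E) &
      (\int[Pr]_w (y w t * (lin w t / (a + b * gquad w)))%:E =
       \int[Pr]_w ((p w t t / (a + b * gquad w) -
        2 * b * lin w t ^+ 2 / (a + b * gquad w) ^+ 2) / 2)%:E)%E].
Proof.
(* [D] contains [outside]: only coordinate [iota t] is integrated, the rest of the row is frozen as
   well. *)
move=> a0 b0; pose D : pred I := fun u => u != iota t.
pose S : measurableType _ := g_sigma_algebraType (cylinders x D).
(* Overwriting coordinate [t] by the free variable removes the only dependence on [v.2] that is not
   measurable for [S]; at $(x_{\iota t}(w), w)$ the true row comes back. *)
pose z (v : R * S) := upd (y v.2) t v.1.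
pose den (v : R * S) := a + b * quad_form (p v.2) (z v).
pose F1 (v : R * S) := v.1 * (lin_form (p v.2) (z v) t / den v).
pose F2 (v : R * S) := (p v.2 t t / den v -
  2 * b * lin_form (p v.2) (z v) t ^+ 2 / den v ^+ 2) / 2.
have mS (f : T -> R) : measurable_fun (setT : set S) f ->
    measurable_fun (setT : set (measurableTypeR R * S)) (fun v : R * S => f v.2).
  by move=> mf; exact: (measurableT_comp mf measurable_snd).
have mpS u v : measurable_fun (setT : set (measurableTypeR R * S))
    (fun w : R * S => p w.2 u v).
  apply: (mS (fun w => p w u v)); apply: measurable_cylinders (mp u v) => i io.
  by apply/eqP => ie; move/negP: (io : i \notin codom iota); rewrite ie codom_f.
have mz u : measurable_fun (setT : set (measurableTypeR R * S))
    (fun w : R * S => z w u).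
  rewrite /z /upd; case: eqP => [_|/eqP ut]; first exact: measurable_fst.
  by apply: (mS (x (iota u))); apply: measurable_coord; rewrite /D (inj_eq iota_inj).
have mlin u : measurable_fun (setT : set (measurableTypeR R * S))
    (fun w : R * S => lin_form (p w.2) (z w) u).
  by apply: measurable_sum => v; exact: measurable_funM.
have mquad : measurable_fun (setT : set (measurableTypeR R * S))
    (fun w : R * S => quad_form (p w.2) (z w)).
  by apply: measurable_sum => v; exact: measurable_funM.
have mden : measurable_fun (setT : set (measurableTypeR R * S)) den.
  by apply: measurable_funD => //; exact: measurable_funM.
have mdenV : measurable_fun (setT : set (measurableTypeR R * S))
    (fun w : R * S => (den w)^-1).
  exact: (measurableT_comp (@measurable_inv R) mden).
have mF1 : measurable_fun (setT : set (measurableTypeR R * S)) F1.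
  by apply: measurable_funM; [exact: measurable_fst|exact: measurable_funM].
have mF2 : measurable_fun (setT : set (measurableTypeR R * S)) F2.
  apply: measurable_funM => //; apply: measurable_funB; first exact: measurable_funM.
  apply: measurable_funM.
    by apply: measurable_funM => //; exact: measurable_funX.
  exact: (measurableT_comp (@measurable_inv R) (measurable_funX 2 mden)).
pose C := 2 / a + b^-1.
have aV : 0 < a^-1 by rewrite invr_gt0.
have bV : 0 < b^-1 by rewrite invr_gt0.
have F1C v : `|F1 v| <= C * (1 + `|v.1|).
  rewrite normrM mulrC; apply: ler_pM => //; last by rewrite lerDr.
  apply: le_trans (ratio_le a0 b0 (lin_form_sqr_le (p_sym _) (p_idem _) _ _)) _.
  by rewrite /C; lra.
have F2C v : `|F2 v| <= C * (1 + `|v.1|).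
  rewrite normrM.
  have h := ratio_deriv_le a0 b0 (idem_diag (p_sym v.2) (p_idem v.2) t)
    (lin_form_sqr_le (p_sym v.2) (p_idem v.2) (z v) t).
  apply: (@le_trans _ _ C); last by rewrite ler_peMr ?lerDl// /C; lra.
  rewrite (@ger0_norm _ 2^-1)// ler_pdivrMr// (le_trans h)// /C; lra.
have F12 w : (\int[gauss R]_s (F1 (s, w))%:E = \int[gauss R]_s (F2 (s, w))%:E)%E.
  have h s : (p w t t * s + lin_form (p w) (upd (y w) t 0) t) ^+ 2 <=
      p w t t * s ^+ 2 + 2 * lin_form (p w) (upd (y w) t 0) t * s +
      quad_form (p w) (upd (y w) t 0).
    rewrite -quad_form_upd//.
    by rewrite -lin_form_upd; apply: lin_form_sqr_le; [exact: p_sym|exact: p_idem].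
  have := gauss_ibp_ratio a0 b0 (idem_diag (p_sym w) (p_idem w) t) h.
  move=> /= e; transitivity (\int[gauss R]_s (s *
      ((p w t t * s + lin_form (p w) (upd (y w) t 0) t) /
       (a + b * (p w t t * s ^+ 2 + 2 * lin_form (p w) (upd (y w) t 0) t * s +
        quad_form (p w) (upd (y w) t 0)))))%:E)%E.
    apply: eq_integral => s _; rewrite /F1 /den /z /= (quad_form_upd (p_sym w) _ _ s).
    by rewrite (lin_form_upd (p w) (y w) t s t).
  rewrite e; apply: eq_integral => s _; rewrite /F2 /den /z /= (quad_form_upd (p_sym w) _ _ s).
  by rewrite (lin_form_upd (p w) (y w) t s t).
have XY (B : set R) (A : set S) : measurable B -> measurable A ->
    Pr (x (iota t) @^-1` B `&` idfun @^-1` A) = (gauss R B * Pr (idfun @^-1` A))%E.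
  move=> mB mA; rewrite preimage_id; apply: (cylinders_indep mx x_iid (D := D)) => //.
  by rewrite /D eqxx.
have := indep_exchange (mx (iota t)) (measurable_id_cylinders mx (D := D)) XY
  mF1 mF2 (@gauss_integrable_moment R) F1C F2C F12.
have zE w : z (x (iota t) w, w) = y w by exact: upd_id.
have F1E w : F1 (x (iota t) w, w) = y w t * (lin w t / (a + b * gquad w)).
  by rewrite /F1 /den zE.
have F2E w : F2 (x (iota t) w, w) = (p w t t / (a + b * gquad w) -
    2 * b * lin w t ^+ 2 / (a + b * gquad w) ^+ 2) / 2.
  by rewrite /F2 /den zE.
move=> [i1 i2 e12]; split.
- by apply: eq_integrable i1 => // w _; rewrite -F1E.
- by apply: eq_integrable i2 => // w _; rewrite -F2E.
- rewrite (eq_integral _ _ (fun w _ => congr1 EFin (esym (F1E w)))) e12.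
  by apply: eq_integral => w _; rewrite F2E.
Qed.

(** Sum of the coordinate identities: $\sum_t y_t (Py)_t$ and $\sum_t (Py)_t^2$ both equal the
    quadratic form. The factor 1/2 is the variance. *)
Lemma gauss_quad_identity (a b : R) : 0 < a -> 0 < b ->
  (\int[Pr]_w (gquad w / (a + b * gquad w))%:E =
   \int[Pr]_w ((\sum_t p w t t) / 2 / (a + b * gquad w) -
               b * gquad w / (a + b * gquad w) ^+ 2)%:E)%E.
Proof.
move=> a0 b0; have st t := gauss_stein_coord t a0 b0.
transitivity (\int[Pr]_w (\sum_t (y w t * (lin w t / (a + b * gquad w)))%:E))%E.
  apply: eq_integral => w _; rewrite sumEFin; congr EFin.
  by rewrite /gquad /quad_form mulr_suml; apply: eq_bigr => t _; rewrite mulrA.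
rewrite integral_sum//; last by move=> t; case: (st t).
transitivity (\sum_t \int[Pr]_w ((p w t t / (a + b * gquad w) -
        2 * b * lin w t ^+ 2 / (a + b * gquad w) ^+ 2) / 2)%:E)%E.
  by apply: eq_bigr => t _; case: (st t).
rewrite -integral_sum//; last by move=> t; case: (st t).
apply: eq_integral => w _; rewrite sumEFin; congr EFin.
rewrite -mulr_suml big_split/= sumrN -!mulr_suml -mulr_sumr.
rewrite sum_lin_form_sqr; [|exact: p_sym|exact: p_idem].
rewrite -/(gquad w); set Q := _ ^+ 2.
have h2 : 2 * 2^-1 = 1 :> R by rewrite mulfV.
transitivity ((\sum_t p w t t) / 2 / (a + b * gquad w) -
   2 * 2^-1 * (b * gquad w / Q)); first by ring.
by rewrite h2 mul1r.
Qed.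

Variable m : R.
Hypothesis m1 : 1 < m.
(** [m] is the complex rank, half the real trace; rank-deficient samples account for the exceptional
    null set. *)
Hypothesis trp : {ae Pr, forall w, \sum_t p w t t = 2 * m}.

Let den_gt0 (a b : R) w : 0 < a -> 0 < b -> 0 < a + b * gquad w.
Proof. by move=> a0 b0; rewrite ltr_wpDr// mulr_ge0 ?gquad_ge0// ltW. Qed.

Let measurable_den_inv (a b : R) : measurable_fun setT (fun w => (a + b * gquad w)^-1).
Proof.
apply: (measurableT_comp (@measurable_inv R)).
by apply: measurable_funD => //; apply: measurable_funM => //; exact: measurable_gquad.
Qed.

Let measurable_ratio (a b : R) : measurable_fun setT (fun w => gquad w / (a + b * gquad w)).
Proof. by apply: measurable_funM; [exact: measurable_gquad|exact: measurable_den_inv]. Qed.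

Let measurable_rhs (a b : R) : measurable_fun setT
  (fun w => ((\sum_t p w t t) / 2 / (a + b * gquad w) -
               b * gquad w / (a + b * gquad w) ^+ 2)%:E).
Proof.
apply/measurable_EFinP; apply: measurable_funB.
  apply: measurable_funM; last exact: measurable_den_inv.
  by apply: measurable_funM => //; apply: measurable_sum => t; exact: measurable_p.
apply: measurable_funM; first by apply: measurable_funM => //; exact: measurable_gquad.
under eq_fun do rewrite -exprVn.
exact: (measurable_funX 2 (measurable_den_inv a b)).
Qed.

Let quad_identity_ae (a b : R) : 0 < a -> 0 < b ->
  (\int[Pr]_w (gquad w / (a + b * gquad w))%:E =
   \int[Pr]_w (m / (a + b * gquad w) -
               b * gquad w / (a + b * gquad w) ^+ 2)%:E)%E.
Proof.
move=> a0 b0; rewrite gauss_quad_identity//.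
apply: ae_eq_integral; [by []|exact: measurable_rhs| |].
  apply/measurable_EFinP; apply: measurable_funB.
    by apply: measurable_funM => //; exact: measurable_den_inv.
  apply: measurable_funM; first by apply: measurable_funM => //; exact: measurable_gquad.
  under eq_fun do rewrite -exprVn.
  exact: (measurable_funX 2 (measurable_den_inv a b)).
apply: filterS trp => w trw _; rewrite trw; congr (_ / _ - _)%:E.
by rewrite mulrC mulKf.
Qed.

Let bounded_integrable (f : T -> R) (C : R) : measurable_fun setT f ->
  (forall w, `|f w| <= C) -> Pr.-integrable setT (EFin \o f).
Proof.
move=> mf fC; have iC := finite_measure_integrable_cst Pr C measurableT.
apply: le_integrable iC => //; first exact/measurable_EFinP.
by move=> w _ /=; rewrite lee_fin (le_trans (fC w))// ler_norm.
Qed.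

Let integral_Pr_cst (c : R) : (\int[Pr]_w c%:E = c%:E)%E.
Proof.
rewrite integral_cst//.
by rewrite [X in (_ * X)%E](probability_setT Pr) mule1.
Qed.

(** In the identity the subtracted term is nonnegative, and $m/(1 + eX) \le m$. *)
Lemma quad_ratio_expect_le (e : R) : 0 < e ->
  (\int[Pr]_w (gquad w / (1 + e * gquad w))%:E <= m%:E)%E.
Proof.
move=> e0; rewrite quad_identity_ae//.
have D0 w := den_gt0 w (@ltr01 R) e0.
have m0 : 0 < m by exact: lt_trans m1.
have h1 w : 0 <= m / (1 + e * gquad w) <= m.
  rewrite divr_ge0 ?(ltW m0) ?(ltW (D0 w))//= ler_pdivrMr//.
  by rewrite ler_peMr ?(ltW m0)// lerDl mulr_ge0 ?gquad_ge0// ltW.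
have h2 w : 0 <= e * gquad w / (1 + e * gquad w) ^+ 2 <= 1.
  have eX : 0 <= e * gquad w by rewrite mulr_ge0 ?gquad_ge0// ltW.
  rewrite (divr_ge0 eX) ?sqr_ge0//= ler_pdivrMr ?exprn_gt0// mul1r.
  by have := sqr_ge0 (e * gquad w); rewrite sqrrD expr1n; lra.
have mf : measurable_fun setT (fun w => m / (1 + e * gquad w) -
    e * gquad w / (1 + e * gquad w) ^+ 2).
  apply: measurable_funB.
    by apply: measurable_funM => //; exact: measurable_den_inv.
  apply: measurable_funM; first by apply: measurable_funM => //; exact: measurable_gquad.
  under eq_fun do rewrite -exprVn.
  exact: (measurable_funX 2 (measurable_den_inv 1 e)).
apply: (@le_trans _ _ (\int[Pr]_w m%:E)%E); last first.
  by rewrite integral_Pr_cst.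
apply: le_integral => //.
- apply: (bounded_integrable (C := m + 1)) => // w; rewrite ler_norml.
  by move: (h1 w) (h2 w) => /andP[? ?] /andP[? ?]; apply/andP; split; lra.
- exact: finite_measure_integrable_cst.
- by move=> w _; rewrite lee_fin; move: (h1 w) (h2 w) => /andP[? ?] /andP[? ?]; lra.
Qed.

(** As $X/(e+X)^2 \le 1/(e+X)$, the identity gives $(m-1)\, E (e+X)^{-1} \le E [X/(e+X)] \le 1$. *)
Lemma quad_inv_expect_le (e : R) : 0 < e ->
  (\int[Pr]_w (e + gquad w)^-1%:E <= (m - 1)^-1%:E)%E.
Proof.
move=> e0.
have D0 w : 0 < e + gquad w by rewrite ltr_wpDr ?gquad_ge0.
have D1 w : e + 1 * gquad w = e + gquad w by rewrite mul1r.
have id_ : (\int[Pr]_w (gquad w / (e + gquad w))%:E =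
    \int[Pr]_w (m / (e + gquad w) - gquad w / (e + gquad w) ^+ 2)%:E)%E.
  transitivity (\int[Pr]_w (gquad w / (e + 1 * gquad w))%:E)%E.
    by apply: eq_integral => w _; rewrite D1.
  rewrite (quad_identity_ae e0 ltr01).
  by apply: eq_integral => w _; rewrite D1 mul1r.
have m10 : 0 < m - 1 by rewrite subr_gt0.
have mi : measurable_fun setT (fun w => (e + gquad w)^-1).
  by under eq_fun do rewrite -D1; exact: measurable_den_inv.
have Dle w : (e + gquad w)^-1 <= e^-1.
  by rewrite lef_pV2 ?posrE// lerDl gquad_ge0.
have h1 w : 0 <= gquad w / (e + gquad w) <= 1.
  by rewrite divr_ge0 ?gquad_ge0 ?(ltW (D0 w))//= ler_pdivrMr// mul1r lerDr ltW.
have h2 w : gquad w / (e + gquad w) ^+ 2 = gquad w / (e + gquad w) * (e + gquad w)^-1.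
  by rewrite expr2 invfM mulrA.
have iinv : Pr.-integrable setT (fun w => (e + gquad w)^-1%:E).
  apply: (bounded_integrable (C := e^-1)) => // w.
  by rewrite ger0_norm// invr_ge0 ltW.
have imi : Pr.-integrable setT (fun w => (m - 1)%:E * (e + gquad w)^-1%:E)%E.
  exact: integrableZl.
have key : ((m - 1)%:E * \int[Pr]_w (e + gquad w)^-1%:E <= 1%:E)%E.
  rewrite -integralZl//.
  apply: (@le_trans _ _ (\int[Pr]_w (gquad w / (e + gquad w))%:E)%E); last first.
    apply: (@le_trans _ _ (\int[Pr]_w 1%:E)%E); last first.
      by rewrite integral_Pr_cst.
    apply: ge0_le_integral => //.
    - by move=> w _; rewrite lee_fin; case/andP: (h1 w).
    - by apply/measurable_EFinP/measurable_funM => //; exact: measurable_gquad.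
    - by move=> w _; rewrite lee_fin; case/andP: (h1 w).
  rewrite id_; apply: le_integral => //.
  - apply: (bounded_integrable (C := m / e + e^-1)).
      apply: measurable_funB; first exact: measurable_funM.
      under eq_fun do rewrite h2.
      by apply: measurable_funM => //; apply: measurable_funM => //; exact: measurable_gquad.
    move=> w; rewrite h2 (le_trans (ler_normB _ _))// lerD// normrM.
      rewrite !ger0_norm ?invr_ge0 ?(ltW (D0 w)) ?(ltW (lt_trans ltr01 m1))//.
      by rewrite ler_pM2l ?(lt_trans ltr01 m1).
    have Di : 0 <= (e + gquad w)^-1 by rewrite invr_ge0 ltW.
    case/andP: (h1 w) => h10 h11.
    by rewrite (ger0_norm h10) (ger0_norm Di) (le_trans _ (Dle w))// ler_piMl.
  - move=> w _; rewrite -EFinM lee_fin h2 mulrBl mul1r lerD2l lerN2.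
    by case/andP: (h1 w) => h10 h11; rewrite ler_piMl// invr_ge0 ltW.
by rewrite -(@lee_pmul2l _ (m - 1)%:E) ?lte_fin// -EFinM mulfV// gt_eqF.
Qed.

(** Markov's inequality: $c/(c+X)$ is 1 where $X = 0$, and its mean is at most $c/(m-1)$, which
    equals [e] for the chosen [c]. *)
Lemma gquad_null : Pr [set w | gquad w = 0] = 0%E.
Proof.
have mZ : measurable [set w | gquad w = 0].
  rewrite -[X in measurable X]setTI.
  exact: (measurable_gquad measurableT (measurable_set1 0)).
apply/eqP; rewrite eq_le measure_ge0 andbT; apply/lee_addgt0Pr => e e0.
rewrite add0e; have m10 : 0 < m - 1 by rewrite subr_gt0.
have c0 : 0 < e * (m - 1) by rewrite mulr_gt0.
pose c := e * (m - 1).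
have mi : measurable_fun setT (fun w => (c + gquad w)^-1%:E).
  apply/measurable_EFinP; have D1 w : c + gquad w = c + 1 * gquad w by rewrite mul1r.
  by under eq_fun do rewrite D1; exact: measurable_den_inv.
have i0 w : 0 <= (c + gquad w)^-1.
  by rewrite invr_ge0 addr_ge0 ?gquad_ge0// ltW.
rewrite -[X in Pr X]setIT -integral_indic//.
apply: (@le_trans _ _ (\int[Pr]_w (c%:E * (c + gquad w)^-1%:E))%E).
  apply: ge0_le_integral => //.
  - exact/measurable_EFinP/measurable_indic.
  - by apply: emeasurable_funM => //; exact: measurable_cst.
  - move=> w _; rewrite -EFinM lee_fin indicE; case: (boolP (w \in _)).
      by rewrite inE/= => ->; rewrite addr0 mulfV// gt_eqF.
    by move=> _; rewrite mulr_ge0// ltW.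
rewrite ge0_integralZl//; [|by move=> w _; rewrite lee_fin|by rewrite lee_fin ltW].
apply: (@le_trans _ _ (c%:E * (m - 1)^-1%:E)%E).
  by apply: lee_wpmul2l; [rewrite lee_fin ltW|exact: quad_inv_expect_le].
by rewrite -EFinM /c mulfK// gt_eqF.
Qed.

Let fatou_le (f : nat -> T -> R) (g : T -> R) (c : R) :
  (forall n, measurable_fun setT (f n)) -> (forall n w, 0 <= f n w) ->
  (forall w, f n w @[n --> \oo] --> g w) ->
  (forall n, (\int[Pr]_w (f n w)%:E <= c%:E)%E) ->
  (\int[Pr]_w (g w)%:E <= c%:E)%E.
Proof.
move=> mf f0 fg fc.
rewrite (eq_integral (fun w => limn_einf (fun n => (f n w)%:E))); last first.
  move=> w _; apply/esym; apply: (cvg_limn_einf_sup _).1.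
  by apply: cvg_EFin; [exact: nearW|exact: fg].
apply: (le_trans (fatou _ _ _ _)) => [//|n|n w _|].
- exact/measurable_EFinP.
- by rewrite lee_fin.
- rewrite limn_einf_lim; apply: lime_le; first exact: is_cvg_einfs.
  apply: nearW => n; apply: le_trans (fc n); apply: ereal_inf_lbound.
  by exists n => /=.
Qed.

Let inv_nat_cvg0 : (n.+1%:R^-1 : R) @[n --> \oo] --> (0 : R).
Proof. exact: cvg_harmonic. Qed.

(** Fatou along $X/(1 + X/(n+1))$, which tends to $X$. *)
Lemma gquad_expect_le : (\int[Pr]_w (gquad w)%:E <= m%:E)%E.
Proof.
apply: (@fatou_le (fun n w => gquad w / (1 + n.+1%:R^-1 * gquad w))).
- by move=> n; exact: measurable_ratio.
- by move=> n w; rewrite divr_ge0 ?gquad_ge0// addr_ge0// mulr_ge0 ?gquad_ge0.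
- move=> w; rewrite -[X in _ --> X]mulr1; apply: cvgM; first exact: cvg_cst.
  have h : (1 + n.+1%:R^-1 * gquad w) @[n --> \oo] --> (1 + 0 * gquad w).
    apply: cvgD; first exact: cvg_cst.
    by apply: cvgM; [exact: inv_nat_cvg0|exact: cvg_cst].
  rewrite mul0r addr0 in h; have := cvgV (oner_neq0 R) h.
  by rewrite invr1 => h2; exact: h2.
- by move=> n; apply: quad_ratio_expect_le; rewrite invr_gt0 ltr0n.
Qed.

Lemma gquad_inv_expect_le : (\int[Pr]_w (gquad w)^-1%:E <= (m - 1)^-1%:E)%E.
Proof.
pose e n : R := n.+1%:R^-1; have e0 n : 0 < e n by rewrite invr_gt0 ltr0n.
have me n : measurable_fun setT (fun w => (e n + gquad w)^-1).
  have D1 w : e n + gquad w = e n + 1 * gquad w by rewrite mul1r.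
  by under eq_fun do rewrite D1; exact: measurable_den_inv.
have D0 n w : 0 < e n + gquad w by rewrite ltr_wpDr ?gquad_ge0.
(* The factor X / X keeps the limit equal to X^-1 = 0 where X vanishes. *)
pose f n w := gquad w / gquad w * (e n + gquad w)^-1.
have f0 n w : 0 <= f n w by rewrite mulr_ge0 ?divr_ge0 ?gquad_ge0// invr_ge0 ltW.
have mf n : measurable_fun setT (f n).
  apply: measurable_funM => //; apply: measurable_funM; first exact: measurable_gquad.
  exact: (measurableT_comp (@measurable_inv R) measurable_gquad).
apply: (@fatou_le f) => // [w|n].
  rewrite /f; have [->|X0] := eqVneq (gquad w) 0.
    by rewrite mul0r invr0; under eq_fun do rewrite mul0r; exact: cvg_cst.
  rewrite mulfV//; under eq_fun do rewrite mul1r.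
  apply: cvgV => //; rewrite -[X in _ --> X]add0r; apply: cvgD; last exact: cvg_cst.
  exact: inv_nat_cvg0.
apply: le_trans (quad_inv_expect_le (e0 n)); apply: ge0_le_integral => //.
- by move=> w _; rewrite lee_fin.
- exact/measurable_EFinP.
- exact/measurable_EFinP.
- move=> w _; rewrite lee_fin /f; have [->|X0] := eqVneq (gquad w) 0.
    by rewrite mul0r mul0r invr_ge0 addr0 ltW.
  by rewrite mulfV// mul1r.
Qed.

End GaussianQuadraticForm.

(** * The channel matrix *)

Section ComplexMeasurable.
Context d (S : measurableType d) (R : realType).
Local Notation C := R[i].

Definition cmeasurable (f : S -> C) :=
  measurable_fun setT (fun w => complex.Re (f w)) /\
  measurable_fun setT (fun w => complex.Im (f w)).

Lemma cmeasurable_cst c : cmeasurable (fun=> c).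
Proof. by split; exact: measurable_cst. Qed.

Lemma cmeasurableD f g : cmeasurable f -> cmeasurable g ->
  cmeasurable (fun w => f w + g w).
Proof.
move=> [fr fi] [gr gi]; split; under eq_fun do rewrite raddfD /=;
  exact: measurable_funD.
Qed.

Lemma cmeasurableM f g : cmeasurable f -> cmeasurable g ->
  cmeasurable (fun w => f w * g w).
Proof.
have ReM (u v : C) : complex.Re (u * v) =
    complex.Re u * complex.Re v - complex.Im u * complex.Im v.
  by case: u v => [a b] [a' b'].
have ImM (u v : C) : complex.Im (u * v) =
    complex.Re u * complex.Im v + complex.Im u * complex.Re v.
  by case: u v => [a b] [a' b'].
move=> [fr fi] [gr gi]; split.
  under eq_fun do rewrite ReM.
  by apply: measurable_funB; exact: measurable_funM.
under eq_fun do rewrite ImM.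
by apply: measurable_funD; exact: measurable_funM.
Qed.

Lemma cmeasurable_conj f : cmeasurable f -> cmeasurable (fun w => (f w)^*%C).
Proof.
have ReJ (u : C) : complex.Re u^*%C = complex.Re u by case: u.
have ImJ (u : C) : complex.Im u^*%C = - complex.Im u by case: u.
move=> [fr fi]; split; first by under eq_fun do rewrite ReJ.
by under eq_fun do rewrite ImJ; exact: measurableT_comp.
Qed.

(** $u^{-1} = \bar u / |u|^2$, also at $u = 0$, where both sides are 0. *)
Lemma cmeasurableV f : cmeasurable f -> cmeasurable (fun w => (f w)^-1).
Proof.
have ReV (u : C) : complex.Re u^-1 = complex.Re u * (abs2 u)^-1 by case: u.
have ImV (u : C) : complex.Im u^-1 = - (complex.Im u * (abs2 u)^-1) by case: u.
move=> [fr fi].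
have ma : measurable_fun setT (fun w => (abs2 (f w))^-1).
  apply: (measurableT_comp (@measurable_inv R)).
  by apply: measurable_funD; exact: measurable_funX.
split; first by under eq_fun do rewrite ReV; exact: measurable_funM.
under eq_fun do rewrite ImV; apply: measurableT_comp => //.
exact: measurable_funM.
Qed.

Lemma cmeasurable_sum (I : Type) (r : seq I) (P : pred I) (f : I -> S -> C) :
  (forall i, cmeasurable (f i)) -> cmeasurable (fun w => \sum_(i <- r | P i) f i w).
Proof.
move=> mf; elim: r => [|i r IH].
  by under eq_fun do rewrite big_nil; exact: cmeasurable_cst.
under eq_fun do rewrite big_cons; case: (P i) => //.
by apply: cmeasurableD.
Qed.

Lemma cmeasurable_prod (I : Type) (r : seq I) (P : pred I) (f : I -> S -> C) :
  (forall i, cmeasurable (f i)) -> cmeasurable (fun w => \prod_(i <- r | P i) f i w).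
Proof.
move=> mf; elim: r => [|i r IH].
  by under eq_fun do rewrite big_nil; exact: cmeasurable_cst.
under eq_fun do rewrite big_cons; case: (P i) => //.
by apply: cmeasurableM.
Qed.

Definition mx_measurable m n (A : S -> 'M[C]_(m, n)) :=
  forall i j, cmeasurable (fun w => A w i j).

Lemma mx_measurable_ctr m n (A : S -> 'M[C]_(m, n)) :
  mx_measurable A -> mx_measurable (fun w => ctrmx (A w)).
Proof. by move=> mA i j; under eq_fun do rewrite ctrmxE; exact: cmeasurable_conj. Qed.

Lemma mx_measurableM m n p (A : S -> 'M[C]_(m, n)) (B : S -> 'M[C]_(n, p)) :
  mx_measurable A -> mx_measurable B -> mx_measurable (fun w => A w *m B w).
Proof.
move=> mA mB i j; under eq_fun do rewrite mxE; apply: cmeasurable_sum => k.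
exact: cmeasurableM.
Qed.

Lemma mx_measurable_det n (A : S -> 'M[C]_n) :
  mx_measurable A -> cmeasurable (fun w => \det (A w)).
Proof.
move=> mA; apply: cmeasurable_sum => s; apply: cmeasurableM.
  exact: cmeasurable_cst.
by apply: cmeasurable_prod => i; exact: mA.
Qed.

Lemma mx_measurable_adj n (A : S -> 'M[C]_n) :
  mx_measurable A -> mx_measurable (fun w => \adj (A w)).
Proof.
move=> mA i j; under eq_fun do rewrite mxE; apply: cmeasurableM.
  exact: cmeasurable_cst.
by apply: mx_measurable_det => k l; under eq_fun do rewrite !mxE; exact: mA.
Qed.

End ComplexMeasurable.

(** * Real form of complex matrices *)

Section RealCoordinates.
Variables (R : realType) (M : nat).
Local Notation C := R[i].

Definition unit_of (b : bool) : C := if b then 'i%C else 1.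

(* The real quadratic form in the real and imaginary parts of u equal to u P u^H. *)
Definition realify (P : 'M[C]_M) (t u : 'I_M * bool) : R :=
  complex.Re (unit_of t.2 * P t.1 u.1 * (unit_of u.2)^*%C).

Lemma realify_sym (P : 'M[C]_M) t u : ctrmx P = P -> realify P t u = realify P u t.
Proof.
move=> hP; rewrite /realify -[in RHS]hP ctrmxE.
have -> (a b c : C) : complex.Re (a * b^*%C * c^*%C) =
    complex.Re (c * b * a^*%C) by case: a b c => [? ?] [? ?] [? ?] /=; ring.
by [].
Qed.

(** As 1 and $i$ are an orthonormal real basis of the complex plane, $\sum_b \mathrm{Re}(z \bar
    u_b)\, \mathrm{Re}(u_b w) = \mathrm{Re}(zw)$. *)
Lemma realify_mul (P Q : 'M[C]_M) t u :
  \sum_v realify P t v * realify Q v u = realify (P *m Q) t u.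
Proof.
rewrite /realify mxE mulr_sumr mulr_suml raddf_sum/=.
rewrite (eq_bigr (fun v => (fun l b => complex.Re (unit_of t.2 * P t.1 l * (unit_of b)^*%C) *
   complex.Re (unit_of b * Q l u.1 * (unit_of u.2)^*%C)) v.1 v.2)); last by move=> [].
rewrite -(pair_bigA _ (fun l b => complex.Re (unit_of t.2 * P t.1 l * (unit_of b)^*%C) *
   complex.Re (unit_of b * Q l u.1 * (unit_of u.2)^*%C)))/=.
apply: eq_bigr => l _; rewrite big_bool/=.
move: (unit_of t.2) (P t.1 l) (Q l u.1) (unit_of u.2) => [? ?] [? ?] [? ?] [? ?].
by rewrite /=; ring.
Qed.

Lemma realify_tr (P : 'M[C]_M) :
  \sum_t realify P t t = 2 * complex.Re (\tr P).
Proof.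
rewrite (eq_bigr (fun v => (fun l b => realify P (l, b) (l, b)) v.1 v.2)); last by move=> [].
rewrite -(pair_bigA _ (fun l b => realify P (l, b) (l, b)))/=.
rewrite raddf_sum/= mulr_sumr; apply: eq_bigr => l _; rewrite big_bool/= /realify/=.
by case: (P l l) => a b /=; ring.
Qed.

Lemma realify_quad (P : 'M[C]_M) (h : 'rV[C]_M) (y : 'I_M * bool -> R) :
  (forall l, h 0 l = (y (l, false) +i* y (l, true))%C) ->
  quad_form (realify P) y = complex.Re ((h *m P *m ctrmx h) 0 0).
Proof.
move=> hy.
have linE t : lin_form (realify P) y t =
    \sum_m (realify P t (m, true) * y (m, true) + realify P t (m, false) * y (m, false)).
  rewrite /lin_form (eq_bigr (fun v => (fun m c => realify P t (m, c) * y (m, c)) v.1 v.2));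
    last by move=> [].
  rewrite -(pair_bigA _ (fun m c => realify P t (m, c) * y (m, c)))/=.
  by apply: eq_bigr => m _; rewrite big_bool.
rewrite /quad_form (eq_bigr
  (fun v => (fun l b => y (l, b) * lin_form (realify P) y (l, b)) v.1 v.2)); last by move=> [].
rewrite -(pair_bigA _ (fun l b => y (l, b) * lin_form (realify P) y (l, b)))/=.
have -> : (h *m P *m ctrmx h) 0 0 = \sum_l \sum_m h 0 l * P l m * (h 0 m)^*%C.
  rewrite mxE exchange_big/=; apply: eq_bigr => m _; rewrite mxE mulr_suml.
  by apply: eq_bigr => l _; rewrite ctrmxE.
rewrite raddf_sum/=; apply: eq_bigr => l _.
rewrite big_bool/= !linE !mulr_sumr -big_split raddf_sum/=.
apply: eq_bigr => m _; rewrite !hy /realify/=; case: (P l m) => a b /=; ring.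
Qed.

End RealCoordinates.

(** * Moments of the residual of a Gaussian row *)

Section ChannelRows.
Context d (T : measurableType d) (R : realType) (Pr : probability T R).
Variables (n M : nat) (G : 'I_n -> 'I_M -> bool -> T -> R).
Hypothesis iidG : iid_CN01 Pr G.
Local Notation C := R[i].
Local Notation H := (chan G).

Let x (t : 'I_n * 'I_M * bool) := G t.1.1 t.1.2 t.2.

Let mx t : measurable_fun setT (x t).
Proof. exact: iidG.1. Qed.

Let x_iid (B : 'I_n * 'I_M * bool -> set R) : (forall t, measurable (B t)) ->
  Pr (\bigcap_(t in setT) (x t @^-1` B t)) = (\prod_t gauss R (B t))%E.
Proof.
move=> mB; have := iidG.2 (fun i j b => B (i, j, b)) (fun i j b => mB _).
have -> : \bigcap_(t in setT) (x t @^-1` B t) = \bigcap_(t in [set: 'I_n * 'I_M * bool])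
    (G t.1.1 t.1.2 t.2 @^-1` B (t.1.1, t.1.2, t.2)).
  by apply: eq_bigcapr => -[[i j] b].
by move=> ->; apply: eq_bigr => -[[i j] b].
Qed.

(** The projection is built from rows other than [i], so the quadratic form bounds apply with rank
    $M - s$, which exceeds 1. Where the selected rows are dependent, [q] takes the value 0. *)
Lemma row_residual_moments s (sel : 'I_s -> 'I_n) (i : 'I_n) :
  i \notin codom sel -> (s.+1 < M)%N ->
  {ae Pr, forall w, row_free (rowsub sel (H w))} ->
  exists q : T -> R, [/\ measurable_fun setT q, forall w, 0 <= q w,
    {ae Pr, forall w, 0 < q w},
    (\int[Pr]_w (q w)%:E <= (M - s)%:R%:E)%E /\
    (\int[Pr]_w (q w)^-1%:E <= ((M - s)%:R - 1)^-1%:E)%E &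
    forall w, row_free (rowsub sel (H w)) ->
      q w = residual (rowsub sel (H w)) (row i (H w))].
Proof.
move=> isel sM fA.
pose iota (t : 'I_M * bool) : 'I_n * 'I_M * bool := (i, t.1, t.2).
have iota_inj : injective iota by move=> [l b] [l' b'] [-> ->].
pose A w := rowsub sel (H w).
pose D w := \det (A w *m ctrmx (A w)).
(* The factor $D D^{-1}$ is 1, or 0 for dependent rows, so [P] is Hermitian and idempotent at every
   sample point. Writing the inverse by the adjugate makes [P] rational in the entries, hence
   measurable in the other rows. *)
pose P w : 'M[C]_M := (D w * (D w)^-1) *:
  (1%:M - (D w)^-1 *: (ctrmx (A w) *m \adj (A w *m ctrmx (A w)) *m A w)).
have PE w : row_free (A w) -> P w = ortho_proj (A w).
  rewrite -gram_row_free => uA; rewrite /P /ortho_proj /invmx uA.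
  have D0 : D w != 0 by rewrite -unitfE -unitmxE.
  by rewrite mulfV// scale1r -scalemxAr -scalemxAl.
have P0 w : ~~ row_free (A w) -> P w = 0.
  rewrite -gram_row_free unitmxE unitfE negbK => /eqP D0.
  by rewrite /P /D D0 mul0r scale0r.
have Pherm w : ctrmx (P w) = P w.
  have [fAw|/P0 ->] := boolP (row_free (A w)); last by rewrite ctrmx0.
  by rewrite PE// ortho_proj_herm.
have Pidem w : P w *m P w = P w.
  have [fAw|/P0 ->] := boolP (row_free (A w)); last by rewrite mulmx0.
  by rewrite PE// ortho_proj_idem// gram_row_free.
pose outside : pred ('I_n * 'I_M * bool) := fun u => u \notin codom iota.
pose S : measurableType _ := g_sigma_algebraType (cylinders x outside).
have mA : mx_measurable (A : S -> 'M[C]_(s, M)).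
  move=> k l; have out b : outside (sel k, l, b).
    apply/codomP => -[[l' b'] [ki _ _]].
    by move/negP: isel; apply; rewrite -ki codom_f.
  split.
    under eq_fun do rewrite !mxE /=.
    exact: (measurable_coord (x := x) (out false)).
  under eq_fun do rewrite !mxE /=.
  exact: (measurable_coord (x := x) (out true)).
have mgram : mx_measurable (fun w : S => A w *m ctrmx (A w)).
  by apply: mx_measurableM => //; exact: mx_measurable_ctr.
have mD : cmeasurable (D : S -> C) by exact: mx_measurable_det.
have mP : mx_measurable (P : S -> 'M[C]_M).
  have mB : mx_measurable
      (fun w : S => ctrmx (A w) *m \adj (A w *m ctrmx (A w)) *m A w).
    apply: mx_measurableM => //; apply: mx_measurableM.
      exact: mx_measurable_ctr.
    exact: mx_measurable_adj.
  move=> k l; have PklE w : P w k l = D w * (D w)^-1 * ((1%:M : 'M[C]_M) k l + (-1) * ((D w)^-1 *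
      (ctrmx (A w) *m \adj (A w *m ctrmx (A w)) *m A w) k l)).
    by rewrite !mxE mulN1r.
  under eq_fun do rewrite PklE; apply: cmeasurableM.
    by apply: cmeasurableM => //; exact: cmeasurableV.
  apply: cmeasurableD; first exact: cmeasurable_cst.
  apply: cmeasurableM; first exact: cmeasurable_cst.
  by apply: cmeasurableM; [exact: cmeasurableV|exact: mB].
pose p w := realify (P w).
have mp t u : measurable_fun (setT : set S) (fun w => p w t u).
  suff : cmeasurable (fun w : S => unit_of R t.2 * P w t.1 u.1 * (unit_of R u.2)^*%C).
    by case.
  apply: cmeasurableM; last exact: cmeasurable_cst.
  by apply: cmeasurableM; [exact: cmeasurable_cst|exact: mP].
have p_sym w t u : p w t u = p w u t by exact: realify_sym.
have p_idem w t u : \sum_v p w t v * p w v u = p w t u.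
  by rewrite /p realify_mul Pidem.
have trp : {ae Pr, forall w, \sum_t p w t t = 2 * (M - s)%:R}.
  apply: filterS fA => w fAw; rewrite /p realify_tr PE// ortho_proj_tr ?gram_row_free//.
  rewrite -natrB; last by rewrite ltnW// ltnW.
  by rewrite -(rmorph_nat (real_complex R)).
have m1 : 1 < (M - s)%:R :> R by rewrite ltr1n ltn_subRL addn1.
exists (gquad x iota p); split.
- exact: measurable_gquad.
- by move=> w; exact: gquad_ge0.
- have Z := gquad_null mx x_iid iota_inj mp p_sym p_idem m1 trp.
  exists [set w | gquad x iota p w = 0]; split => //.
    rewrite -[X in measurable X]setTI.
    exact: (measurable_gquad mx mp measurableT (measurable_set1 0)).
  move=> w /= /negP; rewrite -leNgt => q0; apply/eqP; rewrite eq_le q0.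
  exact: gquad_ge0.
- split; first exact: gquad_expect_le.
  exact: gquad_inv_expect_le.
- move=> w fAw; rewrite /gquad /p PE//.
  rewrite (@realify_quad _ _ _ (row i (H w))); last by move=> l; rewrite !mxE.
  by rewrite -residualE// gram_row_free.
Qed.

End ChannelRows.

(** * Almost everywhere comparison of integrals *)

Section IntegralMonotoneAe.
Context d (T : measurableType d) (R : realType).
Variable mu : {measure set T -> \bar R}.

Import HBNNSimple.

(** The integral is a supremum over simple functions below the integrand. Cutting such a function
    off on the null set [N] preserves its integral and brings it below [g]. *)
Lemma ge0_integral_ae_le (f g : T -> \bar R) :
  (forall w, 0 <= f w)%E -> (forall w, 0 <= g w)%E ->
  {ae mu, forall w, (f w <= g w)%E} ->
  (\int[mu]_w f w <= \int[mu]_w g w)%E.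
Proof.
move=> f0 g0 [N [mN N0 fgN]].
have mNC : measurable (~` N) by exact: measurableC.
rewrite ge0_integralTE// ge0_integralTE//.
apply: ge_ereal_sup => _ [h hf <-].
pose h' : {nnsfun T >-> R} := proj_nnsfun h mNC.
have -> : sintegral mu h = sintegral mu h'.
  rewrite -!integralT_nnsfun; apply: ae_eq_integral.
  - by [].
  - exact/measurable_EFinP/measurable_funP.
  - exact/measurable_EFinP/measurable_funP.
  exists N; split => // w; apply: contra_notP => Nw _ /=.
  by rewrite /h' /= mindicE mem_set ?mulr1.
apply: ereal_sup_ubound; exists h' => // w.
rewrite /h' /= mindicE; case: (boolP (w \in _)) => wN; last by rewrite mulr0.
rewrite mulr1; apply: le_trans (hf w) _.
by move: wN; rewrite inE /= => wN; apply: contrapT => /fgN.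
Qed.

(* The capacity gap need not be measurable on the null set of rank-deficient
   channels, hence no measurability hypothesis. *)
Lemma integral_ae_le (f g : T -> \bar R) : {ae mu, forall w, (f w <= g w)%E} ->
  (\int[mu]_w f w <= \int[mu]_w g w)%E.
Proof.
move=> fg; rewrite [leLHS]integralE [leRHS]integralE; apply: leeB.
  apply: ge0_integral_ae_le => //; apply: filterS fg => w fgw.
  by rewrite !funeposE ge_max !le_max fgw lexx orbT.
apply: ge0_integral_ae_le => //; apply: filterS fg => w fgw.
by rewrite !funenegE ge_max !le_max leeN2 fgw lexx orbT.
Qed.

(** The form taken by both logarithmic estimates: affine, with nonnegative slopes, in nonnegative
    variables of bounded mean. *)
Lemma integral_affine_le (P : probability T R) (I : finType) (Z : I -> T -> R)
    (c : R) (a b : I -> R) :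
  (forall i, measurable_fun setT (Z i)) -> (forall i w, 0 <= Z i w) ->
  (forall i, 0 <= a i) -> (forall i, \int[P]_w (Z i w)%:E <= (b i)%:E)%E ->
  P.-integrable setT (fun w => (c + \sum_i a i * Z i w)%:E) /\
  (\int[P]_w (c + \sum_i a i * Z i w)%:E <= (c + \sum_i a i * b i)%:E)%E.
Proof.
move=> mZ Z0 a0 Zb.
have iZ i : P.-integrable setT (EFin \o Z i).
  apply/integrableP; split; first exact/measurable_EFinP.
  under eq_integral do rewrite /= ger0_norm//.
  by apply: le_lt_trans (Zb i) _; rewrite ltry.
have iaZ i : P.-integrable setT (fun w => (a i)%:E * (Z i w)%:E)%E.
  by have h := integrableZl measurableT (a i) (iZ i); exact: h.
have isum : P.-integrable setT (fun w => \sum_i (a i)%:E * (Z i w)%:E)%E.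
  by apply: integrable_sum => // i _; exact: iaZ.
have ic : P.-integrable setT (fun=> c%:E) by exact: finite_measure_integrable_cst.
have E w : ((c + \sum_i a i * Z i w)%:E = c%:E + \sum_i (a i)%:E * (Z i w)%:E)%E.
  by rewrite EFinD -sumEFin.
split.
  by apply: eq_integrable (integrableD _ ic isum) => // w _; rewrite E.
under eq_integral do rewrite E.
rewrite integralD// EFinD integral_cst// [X in (_ * X)%E](probability_setT P) mule1.
apply: leeD2l; rewrite integral_sum// -sumEFin; apply: lee_sum => i _.
rewrite EFinM (integralZl measurableT (iZ i)).
by apply: lee_wpmul2l; [rewrite lee_fin; exact: a0|exact: Zb].
Qed.

End IntegralMonotoneAe.

(** * The Gram determinant as a product of residuals *)

Section GramChain.
Variables (R : realType) (n M : nat).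
Local Notation C := R[i].

(* The indices s - 1, ..., 0, so that passing from s to s.+1 adds s at the head. *)
Definition first_rows s (sn : (s <= n)%N) (a : 'I_s) : 'I_n :=
  widen_ord sn (rev_ord a).

Lemma first_rows_inj s (sn : (s <= n)%N) : injective (first_rows sn).
Proof.
move=> a b /(congr1 val)/= e; apply: rev_ord_inj; exact: val_inj.
Qed.

Lemma first_rows_notin (i : 'I_n) : i \notin codom (first_rows (ltnW (ltn_ord i))).
Proof.
apply/codomP => -[a /(congr1 val)/= e].
by have := ltn_ord (rev_ord a); rewrite /= -e ltnn.
Qed.

Lemma first_rowsS (i : 'I_n) (H : 'M[C]_(n, M)) :
  rowsub (first_rows (ltn_ord i)) H =
  (col_mx (row i H) (rowsub (first_rows (ltnW (ltn_ord i))) H) : 'M[C]_(1 + i, M)).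
Proof.
apply/matrixP => a l; rewrite !mxE; case: splitP => b ab.
  rewrite !mxE; congr (H _ _); apply: val_inj => /=.
  by rewrite ab [b]ord1/= subn1.
rewrite !mxE; congr (H _ _); apply: val_inj => /=.
by rewrite ab.
Qed.

Lemma det_gram_chain (H : 'M[C]_(n, M)) : row_free H ->
  \det (H *m ctrmx H) = (\prod_(i < n)
    residual (rowsub (first_rows (ltnW (ltn_ord i))) H) (row i H))%:C%C.
Proof.
move=> fH; rewrite -(det_gram_rowsub H (@first_rows_inj n (leqnn n))).
(* Indexing by natural numbers lets the induction on [s] run; the default 1 is never met for $s \le
   n$. *)
pose F k := if insub k is Some i
  then residual (rowsub (first_rows (ltnW (ltn_ord i))) H) (row i H) else 1.
have -> : \prod_(i < n)
    residual (rowsub (first_rows (ltnW (ltn_ord i))) H) (row i H) = \prod_(i < n) F i.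
  by apply: eq_bigr => i _; rewrite /F valK.
have key s (sn : (s <= n)%N) : \det (rowsub (first_rows sn) H *m
    ctrmx (rowsub (first_rows sn) H)) = (\prod_(i < s) F i)%:C%C.
  elim: s sn => [|s IH] sn; first by rewrite det_mx00 big_ord0.
  pose i := Ordinal sn.
  have := first_rowsS i H; rewrite (bool_irrelevance (ltn_ord i) sn) => ->.
  rewrite det_gram_col_mx; last first.
    by rewrite gram_row_free row_free_rowsub//; exact: first_rows_inj.
  rewrite IH big_ord_recr/= mulrC rmorphM; congr (_ * (_)%:C%C).
  have := erefl (F (val i)); rewrite {2}/F valK.
  by rewrite (bool_irrelevance (ltn_ord i) sn) => ->.
exact: key.
Qed.

End GramChain.

(** * The expected gap *)

Section ExpectedGap.
Context d (T : measurableType d) (R : realType) (Pr : probability T R).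

(** Induction on the rows: once the first [s] are independent almost surely, the next residual is
    almost surely positive, and it is the factor by which the Gram determinant grows. *)
Lemma row_free_ae n M (G : 'I_n -> 'I_M -> bool -> T -> R) :
  iid_CN01 Pr G -> (n < M)%N -> {ae Pr, forall w, row_free (chan G w)}.
Proof.
move=> iidG nM.
have key s (sn : (s <= n)%N) :
    {ae Pr, forall w, row_free (rowsub (first_rows sn) (chan G w))}.
  elim: s sn => [|s IH] sn.
    by apply: aeW => w; rewrite /row_free -leqn0 rank_leq_row.
  pose i := Ordinal sn; have fA := IH (ltnW (ltn_ord i)).
  have sM : (s.+1 < M)%N by exact: leq_ltn_trans nM.
  have [q [_ _ q0 _ qE]] :=
    row_residual_moments iidG (first_rows_notin i) sM fA.
  apply: filterS2 fA q0 => w fw qw; have r0 := qE w fw.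
  rewrite (bool_irrelevance sn (ltn_ord i)) (first_rowsS i).
  move: (fw); rewrite -!gram_row_free => uA.
  rewrite unitmxE unitfE (det_gram_col_mx uA) mulf_eq0 negb_or -r0.
  by rewrite -unitfE -(unitfE (\det _)) -unitmxE uA andbT unitfE eq_complex/= gt_eqF.
apply: filterS (key n (leqnn n)) => w; rewrite -!gram_row_free !unitmxE.
by rewrite det_gram_rowsub//; exact: first_rows_inj.
Qed.

(** $\ln(1 + x) \le x$ at $x = m/q - 1$. *)
Lemma ln_lower (m q : R) : 0 < m -> 0 < q -> ln m + 1 - m / q <= ln q.
Proof.
move=> m0 q0; have mq0 : 0 < m / q by rewrite divr_gt0.
have := @le_ln1Dx _ (m / q - 1); rewrite ltrBrDl addrN mq0 => /(_ isT).
by rewrite addrC subrK ln_div ?posrE//; lra.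
Qed.

Lemma ln_upper (m q : R) : 0 < m -> 0 < q -> ln q <= ln m + q / m - 1.
Proof. by move=> m0 q0; have := ln_lower q0 m0; lra. Qed.

(** Row [i] is projected off [i] earlier rows in the determinant, leaving rank $M - i$, and off $n -
    1$ rows in [g2], leaving rank $M - n + 1$. Upper estimates of logarithms use the mean and lose
    nothing; the $n$ lower estimates use the inverse mean and lose at most $1/(M-n)$ each. *)
Lemma beta_bar_bounds K N M (G : 'I_(K * N) -> 'I_M -> bool -> T -> R) :
  iid_CN01 Pr G -> (0 < K * N)%N -> (K * N < M)%N ->
  let n := (K * N)%N in
  let S := \sum_(i < n) ln (M - i)%:R - n%:R * ln (M - n).+1%:R in
  (S - n%:R / (M - n)%:R) / ln 2 <= beta_bar Pr G /\
  beta_bar Pr G <= (S + n%:R / (M - n)%:R) / ln 2.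
Proof.
move=> iidG n0 nM n S; have l2 := ln2_gt0 R.
have fH := row_free_ae iidG nM.
have exX (i : 'I_n) : exists q : T -> R, [/\ measurable_fun setT q, forall w, 0 <= q w,
    {ae Pr, forall w, 0 < q w},
    (\int[Pr]_w (q w)%:E <= (M - i)%:R%:E)%E /\
    (\int[Pr]_w (q w)^-1%:E <= ((M - i)%:R - 1)^-1%:E)%E &
    forall w, row_free (chan G w) -> q w = residual
      (rowsub (first_rows (ltnW (ltn_ord i))) (chan G w)) (row i (chan G w))].
  have fA : {ae Pr, forall w, row_free
      (rowsub (first_rows (ltnW (ltn_ord i))) (chan G w))}.
    by apply: filterS fH => w; apply: row_free_rowsub; exact: first_rows_inj.
  have iM : (i.+1 < M)%N by exact: leq_ltn_trans nM.
  have [q [mq q0 qae qm qE]] :=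
    row_residual_moments iidG (first_rows_notin i) iM fA.
  exists q; split=> // w fw; apply: qE; apply: row_free_rowsub fw.
  exact: first_rows_inj.
have exY (j : 'I_n) : exists q : T -> R, [/\ measurable_fun setT q, forall w, 0 <= q w,
    {ae Pr, forall w, 0 < q w},
    (\int[Pr]_w (q w)%:E <= (M - n).+1%:R%:E)%E /\
    (\int[Pr]_w (q w)^-1%:E <= (M - n)%:R^-1%:E)%E &
    forall w, row_free (chan G w) -> q w = g2 (chan G w) j].
  have fA : {ae Pr, forall w, row_free (rowsub (lift j) (chan G w))}.
    by apply: filterS fH => w; apply: row_free_rowsub; exact: lift_inj.
  have jn : j \notin codom (lift j).
    by apply/codomP => -[k jk]; have := neq_lift j k; rewrite -jk eqxx.
  have jM : (n.-1.+1 < M)%N by rewrite prednK.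
  have [q [mq q0 qae [qm qmi] qE]] := row_residual_moments iidG jn jM fA.
  have Mn : (M - n.-1 = (M - n).+1)%N by lia.
  exists q; split=> //.
    by move: qm qmi; rewrite Mn -natr1 addrK natr1.
  by move=> w fw; rewrite qE ?g2_residual//; apply: row_free_rowsub fw; exact: lift_inj.
have [X HX] := choice exX; have [Y HY] := choice exY.
pose mX (i : 'I_n) : R := (M - i)%:R; pose m : R := (M - n).+1%:R.
have m0 : 0 < m by rewrite ltr0n.
have mX0 (i : 'I_n) : 0 < mX i.
  by rewrite ltr0n subn_gt0 (ltn_trans (ltn_ord i)).
have gapE : {ae Pr, forall w, (forall i, 0 < X i w) /\ (forall j, 0 < Y j w) /\
    beta_gap (chan G w) = (\sum_i ln (X i w) - \sum_j ln (Y j w)) / ln 2}.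
  have aX : {ae Pr, forall w, forall i, 0 < X i w}.
    by apply: filter_forall => i; case: (HX i).
  have aY : {ae Pr, forall w, forall j, 0 < Y j w}.
    by apply: filter_forall => j; case: (HY j).
  apply: filterS3 fH aX aY => w fw Xw Yw; split=> //; split=> //.
  have XE i : X i w = residual
      (rowsub (first_rows (ltnW (ltn_ord i))) (chan G w)) (row i (chan G w)).
    by case: (HX i) => _ _ _ _; exact.
  have YE j : Y j w = g2 (chan G w) j by case: (HY j) => _ _ _ _; exact.
  rewrite beta_gapE ?gram_row_free//; last by move=> j; rewrite -YE.
  rewrite (det_gram_chain fw) /=.
  under eq_bigr do rewrite -XE.
  rewrite log2_prod// mulrBl !mulr_suml; congr (_ - _).
  by apply: eq_bigr => j _; rewrite -YE.
have mu0 : 0 < (M - n)%:R :> R by rewrite ltr0n subn_gt0.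
have mE : m - 1 = (M - n)%:R by rewrite /m -natr1 addrK.
have mVY i : measurable_fun setT (fun w => (Y i w)^-1).
  by apply: (measurableT_comp (@measurable_inv R)); case: (HY i).
have mVX i : measurable_fun setT (fun w => (X i w)^-1).
  by apply: (measurableT_comp (@measurable_inv R)); case: (HX i).
(* Majorant of the gap, affine in the [X i] and the inverses of the [Y j], from [ln_upper] for the
   former and [ln_lower] for the latter. *)
pose cU : R := (\sum_i (ln (mX i) - 1) - \sum_(j < n) (ln m + 1)) / ln 2.
pose ZU (i : ('I_n + 'I_n)%type) w := match i with inl i => X i w | inr j => (Y j w)^-1 end.
pose aU (i : ('I_n + 'I_n)%type) : R := match i with inl i => (mX i)^-1 / ln 2 | inr j => m / ln 2 end.
pose bU (i : ('I_n + 'I_n)%type) : R := match i with inl i => mX i | inr j => (M - n)%:R^-1 end.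
(* Majorant of the negated gap, with the roles of [X] and [Y] exchanged, so that the lower bound
   also rests on upper bounds for means. *)
pose cL : R := (\sum_(j < n) (ln m - 1) - \sum_i (ln (mX i) + 1)) / ln 2.
pose ZL (i : ('I_n + 'I_n)%type) w := match i with inl i => (X i w)^-1 | inr j => Y j w end.
pose aL (i : ('I_n + 'I_n)%type) : R := match i with inl i => mX i / ln 2 | inr j => m^-1 / ln 2 end.
pose bL (i : ('I_n + 'I_n)%type) : R := match i with inl i => (mX i - 1)^-1 | inr j => m end.
have [iU leU] : Pr.-integrable setT (fun w => (cU + \sum_i aU i * ZU i w)%:E) /\
    (\int[Pr]_w (cU + \sum_i aU i * ZU i w)%:E <= (cU + \sum_i aU i * bU i)%:E)%E.
  apply: integral_affine_le.
  - by move=> [i|j]; [case: (HX i)|exact: mVY].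
  - by move=> [i|j] w /=; [case: (HX i)|rewrite invr_ge0; case: (HY j)].
  - by move=> [i|j] /=; rewrite divr_ge0 ?invr_ge0 ?ltW.
  - by move=> [i|j] /=; [case: (HX i) => _ _ _ []|case: (HY j) => _ _ _ []].
have [iL leL] : Pr.-integrable setT (fun w => (cL + \sum_i aL i * ZL i w)%:E) /\
    (\int[Pr]_w (cL + \sum_i aL i * ZL i w)%:E <= (cL + \sum_i aL i * bL i)%:E)%E.
  apply: integral_affine_le.
  - by move=> [i|j]; [exact: mVX|case: (HY j)].
  - by move=> [i|j] w /=; [rewrite invr_ge0; case: (HX i)|case: (HY j)].
  - by move=> [i|j] /=; rewrite divr_ge0 ?invr_ge0 ?ltW.
  - by move=> [i|j] /=; [case: (HX i) => _ _ _ []|case: (HY j) => _ _ _ []].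
have UE w : cU + \sum_i aU i * ZU i w =
    (\sum_i (ln (mX i) + X i w / mX i - 1) - \sum_j (ln m + 1 - m / Y j w)) / ln 2.
  rewrite big_sumType/= /cU /aU /=.
  have -> : \sum_i (mX i)^-1 / ln 2 * X i w = (\sum_i X i w / mX i) / ln 2.
    by rewrite mulr_suml; apply: eq_bigr => i _; ring.
  have -> : \sum_j m / ln 2 * (Y j w)^-1 = (\sum_j m / Y j w) / ln 2.
    by rewrite mulr_suml; apply: eq_bigr => j _; ring.
  have -> : \sum_i (ln (mX i) + X i w / mX i - 1) =
      \sum_i (ln (mX i) - 1) + \sum_i X i w / mX i.
    by rewrite -big_split; apply: eq_bigr => i _ /=; ring.
  have -> : \sum_j (ln m + 1 - m / Y j w) = \sum_(j < n) (ln m + 1) - \sum_j m / Y j w.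
    by rewrite -sumrB.
  by ring.
have LE w : cL + \sum_i aL i * ZL i w =
    - ((\sum_i (ln (mX i) + 1 - mX i / X i w) - \sum_j (ln m + Y j w / m - 1)) / ln 2).
  rewrite big_sumType/= /cL /aL /=.
  have -> : \sum_i mX i / ln 2 * (X i w)^-1 = (\sum_i mX i / X i w) / ln 2.
    by rewrite mulr_suml; apply: eq_bigr => i _; ring.
  have -> : \sum_j m^-1 / ln 2 * Y j w = (\sum_j Y j w / m) / ln 2.
    by rewrite mulr_suml; apply: eq_bigr => j _; ring.
  have -> : \sum_j (ln m + Y j w / m - 1) = \sum_(j < n) (ln m - 1) + \sum_j Y j w / m.
    by rewrite -big_split; apply: eq_bigr => j _ /=; ring.
  have -> : \sum_i (ln (mX i) + 1 - mX i / X i w) =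
      \sum_i (ln (mX i) + 1) - \sum_i mX i / X i w.
    by rewrite -sumrB.
  by ring.
have sum1 (c : R) : \sum_(j < n) c = n%:R * c by rewrite sumr_const card_ord mulr_natl.
have sumln (c : R) : \sum_i (ln (mX i) + c) = \sum_i ln (mX i) + n%:R * c.
  by rewrite big_split/= sum1.
have UvE : cU + \sum_i aU i * bU i = (S + n%:R / (M - n)%:R) / ln 2.
  rewrite big_sumType/= /cU /aU /bU /= !sum1 sumln.
  have -> : \sum_i (mX i)^-1 / ln 2 * mX i = n%:R * (1 / ln 2).
    rewrite -sum1; apply: eq_bigr => i _; field.
    by rewrite !gt_eqF ?mX0.
  rewrite /S -/m -mE; field.
  by rewrite !gt_eqF// addrAC subrr add0r.
have LvE : cL + \sum_i aL i * bL i <= - ((S - n%:R / (M - n)%:R) / ln 2).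
  rewrite big_sumType/= /cL /aL /bL /= !sum1 sumln.
  have mX1 (i : 'I_n) : (M - n)%:R <= mX i - 1.
    have iM : (i < M)%N by exact: ltn_trans nM.
    rewrite lerBrDr -[1]/(1%:R) -natrD ler_nat addn1 ltn_sub2l//.
  have hs : \sum_i mX i / ln 2 * (mX i - 1)^-1 <= n%:R * ((1 + (M - n)%:R^-1) / ln 2).
    rewrite -sum1; apply: ler_sum => i _; rewrite mulrAC ler_pM2r ?invr_gt0//.
    have p : 0 < mX i - 1 by exact: lt_le_trans (mX1 i).
    have -> : mX i / (mX i - 1) = 1 + (mX i - 1)^-1 by field; rewrite gt_eqF.
    by rewrite lerD2l lef_pV2 ?posrE.
  apply: (@le_trans _ _ ((n%:R * (ln m - 1) - (\sum_i ln (mX i) + n%:R * 1)) / ln 2 +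
     (n%:R * ((1 + (M - n)%:R^-1) / ln 2) + n%:R * (m^-1 / ln 2 * m)))).
    by rewrite lerD2l lerD2r.
  rewrite le_eqVlt; apply/orP; left; apply/eqP.
  rewrite /S -/m; field.
  by rewrite !gt_eqF.
have hU : (\int[Pr]_w (beta_gap (chan G w))%:E <= ((S + n%:R / (M - n)%:R) / ln 2)%:E)%E.
  rewrite -UvE; apply: le_trans leU; apply: integral_ae_le.
  apply: filterS gapE => w [Xw [Yw ->]]; rewrite lee_fin UE ler_pM2r ?invr_gt0//.
  by apply: lerB; apply: ler_sum => i _; [exact: ln_upper|exact: ln_lower].
have hL : (((S - n%:R / (M - n)%:R) / ln 2)%:E <= \int[Pr]_w (beta_gap (chan G w))%:E)%E.
  apply: (@le_trans _ _ (- \int[Pr]_w (cL + \sum_i aL i * ZL i w)%:E)%E).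
    by rewrite leeNr (le_trans leL)// -EFinN lee_fin.
  rewrite -integralN; last exact: integrable_add_def.
  apply: integral_ae_le; apply: filterS gapE => w [Xw [Yw ->]].
  rewrite -EFinN lee_fin LE opprK ler_pM2r ?invr_gt0//.
  by apply: lerB; apply: ler_sum => i _; [exact: ln_lower|exact: ln_upper].
(* [beta_bar] is defined by [fine], which is faithful only for a finite integral; the two bounds
   provide finiteness. *)
have fI : (\int[Pr]_w (beta_gap (chan G w))%:E)%E \is a fin_num.
  by rewrite fin_numElt (lt_le_trans _ hL) ?ltNyr// (le_lt_trans hU)// ltry.
by split; rewrite -lee_fin /beta_bar fineK.
Qed.

End ExpectedGap.

(** * Sums of logarithms *)

Section LogSum.
Variable R : realType.

(** An antiderivative of the logarithm. *)
Definition xlnx (x : R) := x * ln x - x.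

Lemma ln_succ_bounds (x : R) : 0 < x -> (x + 1)^-1 <= ln (x + 1) - ln x <= x^-1.
Proof.
move=> x0; have x10 : 0 < x + 1 by rewrite addr_gt0.
have := ln_lower x10 x0; have := ln_lower x0 x10.
have -> : (x + 1) / x = 1 + x^-1 by field; rewrite gt_eqF.
have -> : x / (x + 1) = 1 - (x + 1)^-1 by field; rewrite gt_eqF.
by move=> h1 h2; apply/andP; split; lra.
Qed.

(** The integral of $\ln$ over $[x, x+1]$ lies between $\ln x$ and $\ln(x+1)$. *)
Lemma xlnx_step (x : R) : 0 < x ->
  xlnx (x + 1) - xlnx x <= ln (x + 1) <=
  xlnx (x + 1) - xlnx x + (ln (x + 1) - ln x).
Proof.
move=> x0; have x10 : 0 < x + 1 by rewrite addr_gt0.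
have /andP[h1 h2] := ln_succ_bounds x0.
have {}h1 : 1 <= (x + 1) * (ln (x + 1) - ln x).
  by rewrite mulrC -ler_pdivrMr// div1r.
have {}h2 : x * (ln (x + 1) - ln x) <= 1.
  by rewrite mulrC -ler_pdivlMr// div1r.
by rewrite /xlnx; apply/andP; split; lra.
Qed.

(** Both the integrals and the errors telescope; the total error $\ln((D+n)/D)$ stays bounded when
    $D$ is proportional to $n$. *)
Lemma sum_ln_bounds (D n : nat) : (0 < D)%N ->
  xlnx (D + n)%:R - xlnx D%:R <= \sum_(i < n) ln (D + n - i)%:R <=
  xlnx (D + n)%:R - xlnx D%:R + (ln (D + n)%:R - ln D%:R).
Proof.
move=> D0; elim: n => [|n IH].
  by rewrite big_ord0 addn0 !subrr addr0 lexx.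
rewrite big_ord_recl/= subn0 addnS.
under eq_bigr => i _ do rewrite /bump/= add1n subSS.
have := @xlnx_step (D + n)%:R; rewrite ltr0n addn_gt0 D0 natr1 => /(_ isT).
move: IH => /andP[? ?] /andP[? ?]; apply/andP; split; lra.
Qed.

End LogSum.

Unset Implicit Arguments.
Set Strict Implicit.
Set Printing Implicit Defensive.

(* Delta(alpha, KN) = 3/(KN) * bar beta(alpha KN, KN)  -->
   -3 (log2 e + alpha log2 (1 - 1/alpha))  as KN -> oo with alpha KN integer. *)
Theorem theorem3 (R : realType) (alpha : R) (halpha : 1 < alpha) :
  forall eps : R, 0 < eps ->
  exists n0 : nat, forall K N M : nat,
    (0 < K)%N -> (0 < N)%N -> (n0 <= K * N)%N ->
    M%:R = alpha * (K * N)%:R ->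
    forall (d : measure_display) (T : measurableType d) (Pr : probability T R)
           (G : 'I_(K * N) -> 'I_M -> bool -> T -> R),
      iid_CN01 Pr G ->
      `| 3 / (K * N)%:R * beta_bar Pr G
         - (- 3 * (log2 (expR 1) + alpha * log2 (1 - alpha^-1))) | < eps.
Proof.
move=> eps eps0; have l2 := ln2_gt0 R.
have a0 : 0 < alpha by exact: lt_trans halpha.
have a10 : 0 < alpha - 1 by rewrite subr_gt0.
have ia : alpha^-1 < 1 by rewrite invf_lt1.
(* Since $M = \alpha n$, this is exactly $\ln(M/(M-n))$. *)
pose c := - ln (1 - alpha^-1).
have c0 : 0 <= c by rewrite oppr_ge0 ln_le0// gerBl invr_ge0 ltW.
(* Total error in nats: [c] from [sum_ln_bounds], $1/(\alpha-1)$ from [beta_bar_bounds], and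
   $1/(\alpha-1)$ from replacing $n \ln(M-n+1)$ by $n \ln(M-n)$. *)
pose B := c + 2 / (alpha - 1).
have B0 : 0 < B by rewrite ltr_wpDl// divr_gt0.
exists (Num.truncn (3 * B / ln 2 / eps)).+1 => K N M K0 N0 hn ME d T Pr G iidG.
set n := (K * N)%N in ME hn *.
have n0 : (0 < n)%N by rewrite muln_gt0 K0.
have nR0 : 0 < n%:R :> R by rewrite ltr0n.
have nM : (n < M)%N by rewrite -(ltr_nat R) ME ltr_pMl.
have nR : 3 * B / ln 2 / eps < n%:R.
  by apply: lt_le_trans (truncnS_gt _) _; rewrite ler_nat.
have [lo hi] := beta_bar_bounds iidG n0 nM; rewrite -/n in lo hi.
set S := (\sum_(i < n) _ - _) in lo hi.
have DE : (M - n)%:R = (alpha - 1) * n%:R by rewrite natrB 1?ltnW// ME; ring.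
have D0 : 0 < (M - n)%:R :> R by rewrite ltr0n subn_gt0.
have lnMD : ln M%:R - ln (M - n)%:R = c.
  have M0 : 0 < M%:R :> R by rewrite ltr0n (ltn_trans n0).
  have i0 : 0 < 1 - alpha^-1 by rewrite subr_gt0.
  rewrite -(ln_div M0 D0) /c -(lnV i0); congr ln; rewrite ME DE.
  by field; rewrite !gt_eqF.
have nD : n%:R / (M - n)%:R = (alpha - 1)^-1.
  by rewrite DE; field; rewrite !gt_eqF.
have Dn0 : (0 < M - n)%N by rewrite subn_gt0.
have := sum_ln_bounds R n Dn0.
rewrite subnK 1?ltnW// lnMD => /andP[s1 s2].
(* The part $n \ln(M-n)$ cancels against the zero-forcing term up to a constant; the part linear in
   $n$ is the limit. *)
have XE : xlnx M%:R - xlnx (M - n)%:R =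
    n%:R * ln (M - n)%:R + n%:R * (alpha * c - 1) :> R.
  rewrite /xlnx -lnMD; have -> : ln M%:R = c + ln (M - n)%:R :> R by rewrite -lnMD subrK.
  by rewrite ME DE; ring.
have /andP[_ lD] := ln_succ_bounds D0; rewrite natr1 in lD.
have lD0 : ln (M - n)%:R <= ln (M - n).+1%:R :> R.
  by rewrite ler_ln ?posrE ?ltr0n// ler_nat.
have nl1 : n%:R * ln (M - n).+1%:R <= n%:R * ln (M - n)%:R + (alpha - 1)^-1.
  by rewrite -nD -mulrDr (ler_pM2l nR0); lra.
have nl2 : n%:R * ln (M - n)%:R <= n%:R * ln (M - n).+1%:R :> R.
  by rewrite (ler_pM2l nR0).
have bl : (n%:R * (alpha * c - 1) - B) / ln 2 <= beta_bar Pr G.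
  apply: le_trans lo; rewrite ler_pM2r ?invr_gt0// nD /S /B.
  have : 0 < (alpha - 1)^-1 by rewrite invr_gt0.
  lra.
have bu : beta_bar Pr G <= (n%:R * (alpha * c - 1) + B) / ln 2.
  apply: (le_trans hi); rewrite ler_pM2r ?invr_gt0// nD /S /B.
  have : 0 < (alpha - 1)^-1 by rewrite invr_gt0.
  lra.
have -> : - 3 * (log2 (expR 1) + alpha * log2 (1 - alpha^-1)) =
    3 * (alpha * c - 1) / ln 2.
  by rewrite /log2 expRK /c; field; rewrite gt_eqF.
apply: (@le_lt_trans _ _ (3 * B / ln 2 / n%:R)); last first.
  by rewrite ltr_pdivrMr// [ltRHS]mulrC -ltr_pdivrMr.
have E : 3 / n%:R * beta_bar Pr G - 3 * (alpha * c - 1) / ln 2 =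
    3 / n%:R * (beta_bar Pr G - n%:R * (alpha * c - 1) / ln 2).
  by field; rewrite !gt_eqF.
rewrite E normrM ger0_norm ?divr_ge0 ?(ltW nR0)//.
have -> : 3 * B / ln 2 / n%:R = 3 / n%:R * (B / ln 2) by field; rewrite !gt_eqF.
rewrite ler_pM2l ?divr_gt0// ler_norml.
rewrite mulrBl in bl; rewrite [leRHS]mulrDl in bu.
by apply/andP; split; [rewrite lerBrDr addrC|rewrite lerBlDr addrC].
Qed.
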